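(* Let $\Gamma\subset\mathbf{R}^n$. The following implications hold. (1) If $\Gamma$ is a model set modelled on a lattice $\Lambda\subset\mathbf{R}^{m+n}$ and a regular window $W\subset\mathbf{R}^m$, then $\Gamma$ is an almost periodic pattern. (2) If $\Gamma$ is an almost periodic pattern, then $\Gamma$ is weakly almost periodic. (3) If $\Gamma$ is weakly almost periodic, then $\Gamma$ possesses a uniform density.
   Context: Fix an integer $n\ge 1$. Balls are taken with respect to the sup norm: $B(x,R)=\{y\in\mathbf{R}^n : |x_i-y_i|<R \text{ for all } i\}$, and $B_R=B(0,R)$. $\Delta$ denotes symmetric difference. Model set: let $m\ge 1$, let $\Lambda$ be a lattice of $\mathbf{R}^{m+n}$, let $p_1,p_2$ be the projections of $\mathbf{R}^{m+n}=\mathbf{R}^m\times\mathbf{R}^n$ onto $\mathbf{R}^m\times\{0\}\cong\mathbf{R}^m$ and $\{0\}\times\mathbf{R}^n\cong\mathbf{R}^n$ respectively, and let $W\subset\mathbf{R}^m$ be measurable. The model set modelled on $\Lambda$ and the window $W$ is $\Gamma=\{p_2(\lambda) : \lambda\in\Lambda,\ p_1(\lambda)\in W\}\subset\mathbf{R}^n$. (Neither $p_1$ nor $p_2$ is assumed injective on $\Lambda$.) Regular window: $W\subset\mathbf{R}^m$ is regular if for every affine subspace $V\subset\mathbf{R}^m$, $\mathrm{Leb}_V\big(B_V(\partial(V\cap W),\eta)\big)\to 0$ as $\eta\to 0$, where $\mathrm{Leb}_V$ is Lebesgue measure on $V$, the boundary $\partial(V\cap W)$ is taken in $V$, and $B_V(\partial(V\cap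 W),\eta)$ is the set of points of $V$ at distance smaller than $\eta$ from $\partial(V\cap W)$. Delone set: $\Gamma\subset\mathbf{R}^n$ is relatively dense if there is $R_\Gamma>0$ such that each ball of radius at least $R_\Gamma$ contains at least one point of $\Gamma$; uniformly discrete if there is $r_\Gamma>0$ such that each ball of radius at most $r_\Gamma$ contains at most one point of $\Gamma$; Delone if both. For $R>0$ and a set $E\subset\mathbf{R}^n$, $D_R^+(E)=\sup_{x\in\mathbf{R}^n}\frac{\mathrm{Card}(E\cap B(x,R))}{\mathrm{Vol}(B_R)}$. Almost periodic pattern: a Delone set $\Gamma\subset\mathbf{R}^n$ such that for every $\varepsilon>0$ there exists $R_\varepsilon>0$ for which the set $\mathcal{N}_\varepsilon^{R_\varepsilon}=\{v\in\mathbf{R}^n : \forall R\ge R_\varepsilon,\ D_R^+((\Gamma+v)\Delta\Gamma)<\varepsilon\}$ is relatively dense. Weakly almost periodic: a Delone set $\Gamma\subset\mathbf{R}^n$ such that for every $\varepsilon>0$ there exists $R>0$ such that for every $x,y\in\mathbf{R}^n$ there exists $v\in\mathbf{R}^n$ with $$\frac{\mathrm{Card}\Big(\big(B(x,R)\cap\Gamma\big)\Delta\big((B(y,R)\cap\Gamma)-v\big)\Big)}{\mathrm{Vol}(B_R)}\le\varepsilon.$$ Uniform density: a discrete set $\Gamma\subset\mathbf{R}^n$ possesses a uniform density if there is a number $D(\Gamma)$ such that for every $\varepsilon>0$ there exists $R_\varepsilon>0$ such that for every $R>R_\varepsilon$ and every $x\in\mathbf{R}^n$, $\left|\frac{\m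athrm{Card}(B(x,R)\cap\Gamma)}{\mathrm{Vol}(B_R)}-D(\Gamma)\right|<\varepsilon$.
   Formalization: In (1), Γ is additionally assumed to be a Delone set: as stated (1) fails, e.g. the empty window W is regular and gives Γ empty, which is not relatively dense; being Delone is part of the definition of almost periodic pattern, so it is necessary. *)

(* Defs.v *)
From HB Require Import structures.
From mathcomp Require Import all_boot all_order all_algebra.
From mathcomp Require Import all_classical all_reals all_analysis.

Set Implicit Arguments.
Unset Strict Implicit.
Unset Printing Implicit Defensive.

Import Order.TTheory GRing.Theory Num.Theory.
Import numFieldNormedType.Exports.

Local Open Scope classical_set_scope.
Local Open Scope ring_scope.

(* R^k is 'rV[R]_k.  The library's [ball x r] on row vectors is the open ball
   of the sup norm: [ball x r y] says 0 < r and |x_i - y_i| < r for every i. *)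

Section lebesgue.
Context {R : realType} {k : nat}.
Implicit Types (a b : 'rV[R]_k) (A : set 'rV[R]_k).

Definition box a b : set 'rV[R]_k :=
  [set x | forall i, a ord0 i <= x ord0 i <= b ord0 i].

Definition box_vol a b : R := \prod_i (b ord0 i - a ord0 i).

(* Infimum of the total volume of countable covers by boxes.  The index set D
   lets covers be finite or empty, so that for k = 0 (where every box is the
   whole point, of volume 1) this is the counting measure of the point.
   On Lebesgue measurable sets, in particular on open sets, this is Lebesgue
   measure. *)
Definition leb A : \bar R :=
  ereal_inf [set s | exists (D : set nat) (a b : nat -> 'rV[R]_k),
    [/\ (forall i j, a i ord0 j <= b i ord0 j),
        A `<=` \bigcup_(i in D) box (a i) (b i)
      & s = \esum_(i in D) (box_vol (a i) (b i))%:E ]].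

Definition leb_measurable A : Prop := caratheodory_measurable leb A.

End lebesgue.

Section regular_windows.
Context {R : realType} {m : nat}.
Implicit Types (V W S : set 'rV[R]_m).

(* An affine subspace is presented by a point a and an orthonormal basis of its
   direction, the rows of E; the chart is then an isometry from R^k onto the
   subspace for the Euclidean norms. *)
Definition orthonormal_rows {k} (E : 'M[R]_(k, m)) : Prop := E *m E^T = 1%:M.

Definition affine_chart {k} (a : 'rV[R]_m) (E : 'M[R]_(k, m)) (t : 'rV[R]_k) :
  'rV[R]_m := a + t *m E.

Definition affine_subspace {k} (a : 'rV[R]_m) (E : 'M[R]_(k, m)) :
  set 'rV[R]_m := range (affine_chart a E).

Definition affine_leb {k} (a : 'rV[R]_m) (E : 'M[R]_(k, m)) S : \bar R :=
  leb (affine_chart a E @^-1` S).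

(* The boundary of V `&` W for the topology induced on V. *)
Definition rel_boundary V W : set 'rV[R]_m :=
  V `&` (closure (V `&` W) `&` closure (V `\` W)).

Definition rel_thickening V S (eta : R) : set 'rV[R]_m :=
  V `&` \bigcup_(s in S) ball s eta.

Definition regular_window W : Prop :=
  forall (k : nat) (a : 'rV[R]_m) (E : 'M[R]_(k, m)), orthonormal_rows E ->
    let V := affine_subspace a E in
    affine_leb a E (rel_thickening V (rel_boundary V W) eta)
      @[eta --> 0^'+] --> 0%E.

End regular_windows.

Section model_sets.
Context {R : realType}.

Definition lattice {N : nat} (L : set 'rV[R]_N) : Prop :=
  exists2 B : 'M[R]_N, B \in unitmx &
    L = range (fun z : 'rV[int]_N => map_mx intr z *m B).

Definition model_set {m n : nat} (L : set 'rV[R]_(m + n)) (W : set 'rV[R]_m) :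
  set 'rV[R]_n := [set rsubmx l | l in L `&` [set l | W (lsubmx l)]].

End model_sets.

Section patterns.
Context {R : realType} {n : nat}.
Implicit Types (A G : set 'rV[R]_n) (x v : 'rV[R]_n).

Definition relatively_dense G : Prop :=
  exists2 r0 : R, 0 < r0 & forall x r, r0 <= r -> ball x r `&` G !=set0.

Definition uniformly_discrete G : Prop :=
  exists2 r0 : R, 0 < r0 & forall x r, r <= r0 -> is_subset1 (ball x r `&` G).

Definition delone G : Prop := relatively_dense G /\ uniformly_discrete G.

Definition translate v G : set 'rV[R]_n := [set x + v | x in G].

Definition ball_vol (r : R) : R := fine (leb (ball (0 : 'rV[R]_n) r)).

(* Card(A) / Vol(B_r), equal to +oo when A is infinite. *)
Definition card_by_vol A (r : R) : \bar R :=
  ((counting A : \bar R) * (ball_vol r)^-1%:E)%E.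

Definition upper_density (r : R) A : \bar R :=
  ereal_sup (range (fun x => card_by_vol (A `&` ball x r) r)).

Definition almost_periods G (eps r0 : R) : set 'rV[R]_n :=
  [set v | forall r, r0 <= r ->
    (upper_density r (translate v G `+` G) < eps%:E)%E].

Definition almost_periodic_pattern G : Prop :=
  delone G /\
  forall eps : R, 0 < eps ->
    exists2 r0 : R, 0 < r0 & relatively_dense (almost_periods G eps r0).

Definition weakly_almost_periodic G : Prop :=
  delone G /\
  forall eps : R, 0 < eps -> exists2 r : R, 0 < r &
    forall x y, exists v,
      (card_by_vol ((ball x r `&` G) `+` translate (- v) (ball y r `&` G)) r
        <= eps%:E)%E.

(* An infinite [ball x r `&` G] makes the absolute value +oo, so this forces G
   to be locally finite. *)
Definition has_uniform_density G : Prop :=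
  exists d : R, forall eps : R, 0 < eps ->
    exists2 r0 : R, 0 < r0 &
      forall r x, r0 < r ->
        (`|card_by_vol (ball x r `&` G) r - d%:E| < eps%:E)%E.

End patterns.

(* Main.v *)
(** (3) Cutting a large cube into translates of a cube of radius r shows that
    its density is close to that of the small cubes, which weak almost
    periodicity makes almost equal.
    (2) An almost period close to x - y moves the ball at y almost onto the ball
    at x; the points in the remaining shell are counted by packing.
    (1) The vectors rsubmx l with l in the lattice and lsubmx l small are almost
    periods: the points that such a translation moves in or out of the model set
    have their first projection near the boundary of W, relatively to a coset of
    the subspace V spanned by the small first projections.  Only finitely many
    cosets meet the (bounded) boundary of W, regularity covers each relative
    boundary by boxes of small total volume, and since first projections are
    dense in V, the number of lattice points in a strip over a box is at most
    proportional to the volume of the box. *)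

From mathcomp Require Import all_boot all_order all_algebra.
From mathcomp Require Import all_classical all_reals all_analysis.
From mathcomp Require Import finmap zify ring lra.
Require Import Defs.

Set Implicit Arguments.
Unset Strict Implicit.
Unset Printing Implicit Defensive.

Import Order.TTheory GRing.Theory Num.Theory.
Import numFieldNormedType.Exports.

Local Open Scope classical_set_scope.
Local Open Scope ring_scope.

(** The obstacle in (1) is that first projections of lattice points need not be dense in [R^m]:
    their closure may be a union of parallel affine subspaces, and the strip over a box thin across
    these can hold far more points than its volume suggests. Hence the count inside each coset of V.
    A translation with small first projection moves first projections along V, so a point that
    enters or leaves W crosses the boundary of W relative to its coset; this is why regularity is
    asked on every affine subspace. As neither projection need be injective, lattice points are
    counted instead of points of the model set, and they are separated by both projections jointly.
    Volume is an infimum over countable box covers and is handled by counting alone: grid points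
    against packings give the volume of cubes, and compactness makes the covers finite, so that one
    radius serves for all their boxes. *)

(** * Cardinality bounds by duplicate-free lists *)

Section counting_by_lists.
Context {R : realType} {T : choiceType}.
Implicit Types (A B : set T) (s : seq T) (c : R).

(** Bounding duplicate-free lists allows a real bound and asks for no finiteness proof beforehand:
    finiteness is a consequence. *)
Definition atmost A c : Prop :=
  forall s, uniq s -> (forall x, x \in s -> A x) -> (size s)%:R <= c.

(* Junk value: 0 when A is infinite. *)
Definition card A : R := (#|` fset_set A|)%:R.

Lemma atmost_sub A B c : A `<=` B -> atmost B c -> atmost A c.
Proof. by move=> AB Bc s us sA; apply: Bc => // x /sA /AB. Qed.

Lemma atmost_le A c d : c <= d -> atmost A c -> atmost A d.
Proof. by move=> cd Ac s us sA; apply: le_trans cd; exact: Ac. Qed.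

Lemma atmost_finite A c : atmost A c -> finite_set A.
Proof.
move=> Ac; apply: contrapT => iA.
have [F FA nF] := infinite_set_fset (Num.truncn c).+1 iA.
have h : (#|` F|)%:R <= c by apply: Ac (fset_uniq F) _ => x xF; exact: FA.
have c0 : 0 <= c by apply: le_trans h.
have /andP[_ h2] := truncn_itv c0.
have h3 : (Num.truncn c).+1%:R <= (#|` F|)%:R :> R by rewrite ler_nat.
by have := lt_le_trans h2 (le_trans h3 h); rewrite ltxx.
Qed.

Lemma finite_atmost A : finite_set A -> atmost A (card A).
Proof.
move=> fA s us sA; rewrite ler_nat; apply: uniq_leq_size => // x /sA Ax.
by rewrite in_fset_set// mem_set.
Qed.

Lemma atmost_card A c : atmost A c -> card A <= c.
Proof.
move=> Ac; have fA := atmost_finite Ac.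
by apply: Ac (fset_uniq _) _ => x; rewrite in_fset_set// => /set_mem.
Qed.

Lemma countingE A : finite_set A -> counting A = (card A)%:E.
Proof. by move=> fA; rewrite /counting asboolT. Qed.

Lemma card_ge_list A s : finite_set A -> uniq s -> (forall x, x \in s -> A x) ->
  (size s)%:R <= card A.
Proof. by move=> fA; exact: finite_atmost. Qed.

Lemma atmostU A B c d : atmost A c -> atmost B d -> atmost (A `|` B) (c + d).
Proof.
move=> Ac Bd s us sAB.
have -> : size s = (size [seq x <- s | `[< A x >]] +
                    size [seq x <- s | ~~ `[< A x >]])%N.
  by rewrite !size_filter count_predC.
rewrite natrD lerD//.
  by apply: Ac; [exact: filter_uniq|move=> x; rewrite mem_filter => /andP[/asboolP]].
apply: Bd; [exact: filter_uniq|move=> x; rewrite mem_filter => /andP[/asboolP nA xs]].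
by case: (sAB _ xs).
Qed.

Lemma atmost0 : atmost set0 0.
Proof. by case=> // x s _ /(_ x (mem_head _ _)). Qed.

Lemma atmost_bigcup (I : eqType) (l : seq I) (B : I -> set T) (c : I -> R) :
  (forall i, i \in l -> atmost (B i) (c i)) ->
  atmost [set x | exists2 i, i \in l & B i x] (\sum_(i <- l) c i).
Proof.
elim: l => [_|i l IH Bc].
  by rewrite big_nil; apply: atmost_sub atmost0 => x [].
rewrite big_cons.
have h1 := Bc _ (mem_head _ _).
have h2 := IH (fun j jl => Bc j (mem_behead (s := i :: l) jl)).
apply: atmost_sub (atmostU h1 h2) => x [j].
by rewrite inE => /orP[/eqP-> |jl] Bx; [left|right; exists j].
Qed.

Lemma card_setY A B : finite_set A -> finite_set B ->
  `|card A - card B| <= card (A `+` B).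
Proof.
move=> fA fB.
have fY : finite_set (A `+` B).
  by rewrite /setY finite_setU; split; apply: finite_setD.
have aux (C D : set T) : finite_set D -> finite_set (C `+` D) ->
    card C <= card D + card (C `+` D).
  move=> fD fCD; apply: atmost_card.
  apply: atmost_sub (atmostU (finite_atmost fD) (finite_atmost fCD)).
  by move=> x Cx; have [Dx|nDx] := pselect (D x); [left|right; left].
have h1 := aux A B fB fY.
have eYC : A `+` B = B `+` A by rewrite /setY setUC.
have h2 := aux B A fA; rewrite -eYC in h2; have {}h2 := h2 fY.
by rewrite ler_norml; apply/andP; split; lra.
Qed.

Lemma card_disjoint (I : finType) (B : I -> set T) A c :
  finite_set A -> (forall i, B i `<=` A) ->
  (forall i j x, B i x -> B j x -> i = j) ->
  (forall i, c <= card (B i)) -> #|I|%:R * c <= card A.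
Proof.
move=> fA BA Bdis Bc.
have fB i : finite_set (B i) by apply: sub_finite_set fA.
pose l := [seq x | i <- enum I, x <- (fset_set (B i) : seq T)].
have ul : uniq l.
  apply: allpairs_uniq_dep; first exact: enum_uniq.
    by move=> i _; exact: fset_uniq.
  move=> [i x] [j y] /allpairsPdep[i' [x' [_ hx [-> ->]]]].
  move=> /allpairsPdep[j' [y' [_ hy [-> ->]]]] /= exy.
  move: hx hy; rewrite -exy !in_fset_set// => /set_mem hx /set_mem hy.
  by rewrite (Bdis _ _ _ hx hy).
have lA x : x \in l -> A x.
  case/allpairsPdep => i [y [_ hy ->]]; apply: (BA i).
  by move: hy; rewrite in_fset_set// => /set_mem.
apply: le_trans (card_ge_list fA ul lA).
rewrite size_allpairs_dep sumnE big_map natr_sum.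
rewrite -sum1_card natr_sum mulr_suml big_enum /=.
by apply: ler_sum => i _; rewrite mul1r; exact: Bc.
Qed.

End counting_by_lists.

(** A duplicate-free list in the image lifts through a choice of preimages, so [f] need not be
    injective. This is how points of the model set are counted by the lattice points above them. *)
Lemma atmost_image {R : realType} (T U : choiceType) (f : T -> U) (A : set T) (c : R) :
  atmost A c -> atmost (f @` A) c.
Proof.
move=> Ac [|y0 s'] us sA; first by apply: (Ac [::]).
set s := y0 :: s' in us sA *; have y0s : y0 \in s by exact: mem_head.
have [g gP] : exists g : U -> T, forall y, y \in s -> A (g y) /\ f (g y) = y.
  have [x0 _ _] := sA _ y0s.
  have /choice[g gP] : forall y, exists x, y \in s -> A x /\ f x = y.
    move=> y; have [/sA[x Ax fx]|nys] := pselect (y \in s); first by exists x.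
    by exists x0.
  by exists g.
rewrite -(size_map g); apply: Ac.
  rewrite map_inj_in_uniq// => x y xs ys gxy.
  by rewrite -(gP _ xs).2 gxy (gP _ ys).2.
by move=> x /mapP[y ys ->]; exact: (gP _ ys).1.
Qed.

Lemma card_image {R : realType} (T U : choiceType) (f : T -> U) (A : set T) :
  injective f -> finite_set A -> card (f @` A) = card A :> R.
Proof.
move=> fI fA; rewrite /card fset_set_image// card_imfset//.
Qed.

Lemma card_dffun_ord (k : nat) (m : 'I_k -> nat) :
  #|{dffun forall i : 'I_k, 'I_(m i)}| = (\prod_i m i)%N.
Proof.
rewrite card_dep_ffun foldrE big_map big_enum /=.
by apply: eq_bigr => i _; rewrite card_ord.
Qed.

(** * Packing separated points into a box *)

Section packing.
Context {R : realType} {k : nat}.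

(* Each point is sent to the grid cell of side rho that contains it. *)
Lemma packing (T : eqType) (s : seq T) (phi : T -> 'rV[R]_k) (a b : 'rV[R]_k)
    (rho : R) : 0 < rho -> uniq s -> (forall i, a ord0 i <= b ord0 i) ->
  (forall x, x \in s -> box a b (phi x)) ->
  (forall x y, x \in s -> y \in s ->
     (forall i, `|phi x ord0 i - phi y ord0 i| < rho) -> x = y) ->
  (size s)%:R <= \prod_i ((b ord0 i - a ord0 i) / rho + 1).
Proof.
move=> rho0 us ab sab sep.
have c0 i : 0 <= (b ord0 i - a ord0 i) / rho.
  by rewrite divr_ge0 ?subr_ge0 ?ab// ltW.
pose m i := (Num.truncn ((b ord0 i - a ord0 i) / rho)).+1.
pose cell x i := (phi x ord0 i - a ord0 i) / rho.
pose g x : {dffun forall i : 'I_k, 'I_(m i)} :=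
  [ffun i => inord (Num.truncn (cell x i)) : 'I_(m i)].
have cell0 x i : x \in s -> 0 <= cell x i.
  by move=> /sab /(_ i) /andP[h _]; rewrite divr_ge0 ?subr_ge0 ?(ltW rho0).
have gE x i : x \in s -> g x i = Num.truncn (cell x i) :> nat.
  move=> xs; rewrite ffunE inordK// ltnS; apply: le_truncn.
  by rewrite ler_pM2r ?invr_gt0// lerB//; have /andP[] := sab _ xs i.
have gI : {in s &, injective g}.
  move=> x y xs ys gxy; apply: sep => // i.
  have : g x i = g y i :> nat by rewrite gxy.
  rewrite !gE// => e.
  have /andP[x1 x2] := truncn_itv (cell0 _ i xs).
  have /andP[y1 y2] := truncn_itv (cell0 _ i ys).
  rewrite e in x1 x2; rewrite -natr1 in x2 y2.
  have -> : phi x ord0 i - phi y ord0 i = (cell x i - cell y i) * rho.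
    by rewrite /cell mulrBl !divfK ?gt_eqF//; ring.
  rewrite normrM (gtr0_norm rho0) gtr_pMl// ltr_norml; apply/andP; split; lra.
have : (size s <= #|{dffun forall i : 'I_k, 'I_(m i)}|)%N.
  rewrite -(size_map g) -(card_uniqP _) ?max_card//.
  by rewrite map_inj_in_uniq.
rewrite card_dffun_ord -(ler_nat R) natr_prod => /le_trans; apply.
apply: ler_prod => i _; rewrite ler0n /= -natr1 lerD2r.
by have /andP[] := truncn_itv (c0 i).
Qed.

End packing.

(** The small changes of volume needed later are all continuity at 0 of a polynomial in the change
    of side length. *)
Lemma horner_near0 {R : realType} (p : {poly R}) (e : R) : 0 < e ->
  exists2 d : R, 0 < d & forall t, `|t| <= d -> `|p.[t] - p.[0]| < e.
Proof.
move=> e0; have /cvgrPdist_lt /(_ e e0) := @continuous_horner R p 0.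
move=> /nbhs_ballP[d /= d0 h]; exists (d / 2); first by rewrite divr_gt0.
move=> t td; rewrite distrC; apply: h => /=.
by rewrite /ball /= sub0r normrN; apply: le_lt_trans td _;
   rewrite gtr_pMr// invf_lt1//; lra.
Qed.

Section sup_balls.
Context {R : realType} {k : nat}.
Implicit Types (x y v : 'rV[R]_k) (r : R).

Lemma rV_ballP x r y :
  ball x r y <-> 0 < r /\ forall i, `|x ord0 i - y ord0 i| < r.
Proof.
split=> [[r0 h]|[r0 h]]; split => //; first by move=> i; exact: h.
by move=> i j; rewrite ord1; exact: h.
Qed.

Lemma rV_ball_sub x r y s : 0 < s ->
  (forall i, `|x ord0 i - y ord0 i| <= s - r) -> ball x r `<=` ball y s.
Proof.
move=> s0 h z /rV_ballP[r0 xz]; apply/rV_ballP; split=> // i.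
move: (xz i) (h i); rewrite !ltr_norml !ler_norml => /andP[h1 h2] /andP[h3 h4].
by apply/andP; split; lra.
Qed.

Lemma rV_ball_translate x v r y : ball (x + v) r (y + v) <-> ball x r y.
Proof.
by rewrite !rV_ballP; split=> -[r0 h]; split=> // i; move: (h i);
  rewrite !mxE opprD addrACA subrr addr0.
Qed.

End sup_balls.

(** * Box covers and the volume of cubes *)

Section boxes.
Context {R : realType} {k : nat}.
Implicit Types (a b c d : 'rV[R]_k) (A K : set 'rV[R]_k).

Lemma box_vol_ge0 a b : (forall i, a ord0 i <= b ord0 i) -> 0 <= box_vol a b.
Proof. by move=> ab; apply: prodr_ge0 => i _; rewrite subr_ge0. Qed.

Lemma box_compact a b : compact (box a b).
Proof.
have -> : box a b = [set v | forall i, `[a ord0 i, b ord0 i]%classic (v ord0 i)].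
  by apply/seteqP; split => x h i; have := h i; rewrite /= in_itv.
exact: (@rV_compact R k (fun i => `[a ord0 i, b ord0 i]%classic)
  (fun i => @segment_compact R _ _)).
Qed.

Lemma open_box_open a b :
  open [set x : 'rV[R]_k | forall i, a ord0 i < x ord0 i < b ord0 i].
Proof.
rewrite openE => x /= xab.
apply: (@filter_forall _ _ (fun (i : 'I_k) (y : 'rV[R]_k) => a ord0 i < y ord0 i < b ord0 i) (nbhs x)) => i.
have hc := @coord_continuous R 1 k ord0 i x.
have /andP[x1 x2] := xab i.
have h1 := cvgr_gt _ hc _ x1; have h2 := cvgr_lt _ hc _ x2.
by apply: filterS2 (h1 _) (h2 _) => y /= -> ->.
Qed.

Lemma box_enlarge a b (e : R) : 0 < e -> exists2 t : R, 0 < t &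
  box_vol (a - const_mx t) (b + const_mx t) < box_vol a b + e.
Proof.
move=> e0.
pose p : {poly R} := \prod_i ((b ord0 i - a ord0 i)%:P + 2%:R *: 'X).
have pE t : p.[t] = \prod_i (b ord0 i - a ord0 i + 2 * t).
  by rewrite horner_prod; apply: eq_bigr => i _; rewrite !hornerE.
have [t t0 /(_ t)] := horner_near0 p e0; rewrite gtr0_norm// lexx => /(_ isT).
rewrite !pE ltr_norml => /andP[_ h]; exists t => //.
move: h; rewrite /box_vol.
under [X in _ - X]eq_bigr do rewrite mulr0 addr0.
rewrite ltrBlDl; congr (_ < _); apply: eq_bigr => i _; rewrite !mxE; ring.
Qed.

Lemma esum_ge_seq (f : nat -> \bar R) (D : set nat) (s : seq nat) :
  uniq s -> (forall i, i \in s -> D i) ->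
  (\sum_(i <- s) f i <= \esum_(i in D) f i)%E.
Proof.
move=> us sD; apply: esum_ge; exists [set` s]; last by rewrite fsbig_seq.
by split; [exact: finite_seq|move=> i /= /sD].
Qed.

Lemma sum_half_powers_le (s : seq nat) :
  uniq s -> \sum_(i <- s) (2^-1 : R) ^+ i.+1 <= 1.
Proof.
move=> us; pose N := (\max_(i <- s) i).+1.
have sN i : i \in s -> (i < N)%N by move=> h; rewrite ltnS; exact: leq_bigmax_seq.
have pe : perm_eq s [seq i <- iota 0 N | i \in s].
  apply: uniq_perm => // [|i]; first exact: filter_uniq (iota_uniq _ _).
  by rewrite mem_filter mem_iota /= add0n; case: (boolP (i \in s)) => // /sN ->.
rewrite (perm_big _ pe) big_filter big_mkcond /=.
have : \sum_(i <- iota 0 N) (2^-1 : R) ^+ i.+1 = 1 - 2^-1 ^+ N.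
  elim: N {sN pe} => [|N IH]; first by rewrite big_nil expr0 subrr.
  by rewrite -addn1 iotaD big_cat big_seq1 /= IH add0n addn1 !exprS; field.
move=> h; apply: (@le_trans _ _ (1 - 2^-1 ^+ N)).
  by rewrite -h; apply: ler_sum => i _; case: ifP => // _.
by rewrite gerBl exprn_ge0// invr_ge0.
Qed.

(** The slack between the cover's volume and [d] is shared out geometrically to enlarge each box;
    the open enlarged boxes have a finite subcover. Enlarging also makes all sides positive, as the
    strip count requires. *)
Lemma finite_box_cover A K (d : R) : (leb A < d%:E)%E -> compact K -> K `<=` A ->
  exists l : seq ('rV[R]_k * 'rV[R]_k),
    [/\ (forall ab, ab \in l -> forall i, ab.1 ord0 i < ab.2 ord0 i),
        K `<=` [set x | exists2 ab, ab \in l & box ab.1 ab.2 x]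
      & \sum_(ab <- l) box_vol ab.1 ab.2 < d].
Proof.
move=> /ereal_inf_lt[s [D [a [b [ab AD ->]]]] sd] cK KA.
have vol0 i : 0 <= box_vol (a i) (b i) by exact: box_vol_ge0.
have s0 : (0 <= \esum_(i in D) (box_vol (a i) (b i))%:E)%E.
  by apply: esum_ge0 => i _; rewrite lee_fin.
have sf : (\esum_(i in D) (box_vol (a i) (b i))%:E)%E \is a fin_num.
  by rewrite ge0_fin_numE// (lt_trans sd)// ltry.
have [e eE] : exists e, (\esum_(i in D) (box_vol (a i) (b i))%:E)%E = e%:E.
  by exists (fine (\esum_(i in D) (box_vol (a i) (b i))%:E)%E); rewrite fineK.
rewrite eE lte_fin in sd.
pose w i := (d - e) * 2^-1 ^+ i.+1.
have w0 i : 0 < w i by rewrite mulr_gt0 ?subr_gt0// exprn_gt0// invr_gt0.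
have /choice[t tP] : forall i, exists t : R, 0 < t /\
    box_vol (a i - const_mx t) (b i + const_mx t) < box_vol (a i) (b i) + w i.
  by move=> i; have [t ? ?] := box_enlarge (a i) (b i) (w0 i); exists t.
have := cK; rewrite compact_cover => /(_ nat D (fun i => [set x | forall j,
  (a i - const_mx (t i)) ord0 j < x ord0 j < (b i + const_mx (t i)) ord0 j])).
case=> [i _|x /KA /AD[i Di xi]|F FD KF].
- exact: open_box_open.
- exists i => // j; have /andP[x1 x2] := xi j; rewrite !mxE.
  by have [t0 _] := tP i; apply/andP; split; lra.
pose e' := \sum_(i <- F) box_vol (a i) (b i).
have e'e : e' <= e.
  rewrite -lee_fin -eE -sumEFin; apply: esum_ge_seq; first exact: fset_uniq.
  by move=> i /FD /set_mem.
(* The strict inequality on the total volume comes from a first box, so the empty cover is treated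
   apart: its volume is [0 <= e < d]. *)
have [F0|Fn0] := eqVneq (F : seq nat) [::].
  exists [::]; split => //.
    move=> x /KF[i iF _]; have : i \in (F : seq nat) by [].
    by rewrite F0.
  rewrite big_nil; apply: le_lt_trans sd.
  by rewrite -lee_fin -eE.
exists [seq (a i - const_mx (t i), b i + const_mx (t i)) | i <- F]; split.
- move=> _ /mapP[i _ ->] j /=; have [t0 _] := tP i; have := ab i j; rewrite !mxE; lra.
- move=> x /KF[i iF xi]; exists (a i - const_mx (t i), b i + const_mx (t i)).
    by apply/mapP; exists i.
  by move=> j; have /andP[x1 x2] := xi j; rewrite !ltW.
rewrite big_map /=; apply: (@lt_le_trans _ _ (e' + \sum_(i <- F) w i)).
  rewrite -big_split /=; case: (F : seq nat) Fn0 => // i0 F' _.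
  rewrite !big_cons; apply: ltr_leD; first exact: (tP i0).2.
  by apply: ler_sum => j _; apply: ltW; exact: (tP j).2.
rewrite -mulr_sumr.
have := sum_half_powers_le (fset_uniq F).
have de : 0 < d - e by rewrite subr_gt0.
move=> /(ler_wpM2l (ltW de)); rewrite mulr1; lra.
Qed.

(** Volumes are compared through points of a fine grid: by [packing], a covering box with sides
    [s_i] holds at most [\prod_i (s_i / t0 + 1)] of them. Multiplied by [t0 ^ k] this is the
    enlarged volume in [p], which tends to the true one with [t0]. *)
Lemma box_cover_vol c d (l : seq ('rV[R]_k * 'rV[R]_k)) :
  (forall i, c ord0 i <= d ord0 i) ->
  (forall ab, ab \in l -> forall i, ab.1 ord0 i < ab.2 ord0 i) ->
  box c d `<=` [set x | exists2 ab, ab \in l & box ab.1 ab.2 x] ->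
  box_vol c d <= \sum_(ab <- l) box_vol ab.1 ab.2.
Proof.
move=> cd lpos cov; apply/ler_addgt0Pr => e e0.
pose p : {poly R} := \sum_(ab <- l) \prod_i ((ab.2 ord0 i - ab.1 ord0 i)%:P + 'X).
have pE t : p.[t] = \sum_(ab <- l) \prod_i (ab.2 ord0 i - ab.1 ord0 i + t).
  rewrite horner_sum; apply: eq_bigr => ab _.
  by rewrite horner_prod; apply: eq_bigr => i _; rewrite !hornerE.
have p0 : p.[0] = \sum_(ab <- l) box_vol ab.1 ab.2.
  by rewrite pE; apply: eq_bigr => ab _; apply: eq_bigr => i _; rewrite addr0.
have [t0 t00 /(_ t0)] := horner_near0 p e0; rewrite gtr0_norm// lexx => /(_ isT).
rewrite ltr_norml p0 => /andP[_ h].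
suff : box_vol c d <= p.[t0] by move=> h2; apply: (le_trans h2); lra.
(* The grid of mesh t0 based at c has at least vol / t0 ^ k points in the box. *)
pose m i := (Num.truncn ((d ord0 i - c ord0 i) / t0)).+1.
pose I := {dffun forall i : 'I_k, 'I_(m i)}.
pose g (f : I) : 'rV[R]_k := \row_i (c ord0 i + t0 * (f i)%:R).
have gin f : box c d (g f).
  move=> i; rewrite mxE; apply/andP; split.
    by rewrite lerDl mulr_ge0// ltW.
  have fi : (f i <= Num.truncn ((d ord0 i - c ord0 i) / t0))%N.
    by rewrite -ltnS; exact: ltn_ord.
  have : (f i)%:R <= (d ord0 i - c ord0 i) / t0.
    apply: (@le_trans _ _ (Num.truncn ((d ord0 i - c ord0 i) / t0))%:R).
      by rewrite ler_nat.
    have : 0 <= (d ord0 i - c ord0 i) / t0 by rewrite divr_ge0 ?subr_ge0// ltW.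
    by move=> /truncn_itv /andP[].
  by rewrite ler_pdivlMr// mulrC; lra.
have gsep f f' : (forall i, `|g f ord0 i - g f' ord0 i| < t0) -> f = f'.
  move=> hff; apply/ffunP => i; apply/val_inj/eqP; rewrite -(eqr_nat R) /=.
  have := hff i; rewrite !mxE.
  rewrite [X in `|X|](_ : _ = t0 * ((f i)%:R - (f' i)%:R)); last by ring.
  rewrite normrM gtr0_norm// -[ltRHS]mulr1 ltr_pM2l// => hd.
  move: hd; rewrite eqr_nat ltr_norml => /andP[h1 h2].
  have h3 : (f i)%:R < (f' i).+1%:R :> R by rewrite -natr1; lra.
  have h4 : (f' i)%:R < (f i).+1%:R :> R by rewrite -natr1; lra.
  by rewrite !ltr_nat in h3 h4; lia.
have : (#|I|%:R : R) <= \sum_(ab <- l) \prod_i ((ab.2 ord0 i - ab.1 ord0 i) / t0 + 1).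
  have B ab : ab \in l -> atmost [set f | box ab.1 ab.2 (g f)]
      (\prod_i ((ab.2 ord0 i - ab.1 ord0 i) / t0 + 1)).
    move=> abl s us sin; apply: (packing t00 us _ sin) => [i|f f' _ _].
      by apply: ltW; exact: lpos.
    exact: gsep.
  have := atmost_bigcup B => /(_ (enum I) (enum_uniq _)).
  by rewrite -cardE; apply => f _; exact: (cov _ (gin f)).
rewrite card_dffun_ord natr_prod => hcard.
have tk : 0 < t0 ^+ k by rewrite exprn_gt0.
apply: (@le_trans _ _ (t0 ^+ k * \prod_(i < k) (m i)%:R)).
  rewrite -[X in _ ^+ X](card_ord k) -prodr_const -big_split /=.
  apply: ler_prod => i _; rewrite subr_ge0 cd /= mulrC -ler_pdivrMr//.
  have : 0 <= (d ord0 i - c ord0 i) / t0 by rewrite divr_ge0 ?subr_ge0// ltW.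
  by move=> /truncn_itv /andP[_ /ltW].
apply: le_trans (ler_wpM2l (ltW tk) hcard) _.
rewrite pE mulr_sumr; apply: ler_sum => ab _.
rewrite -[X in _ ^+ X](card_ord k) -prodr_const -big_split /=.
rewrite le_eqVlt; apply/orP; left; apply/eqP; apply: eq_bigr => i _.
by rewrite mulrDr mulr1 mulrC divfK// gt_eqF.
Qed.

Lemma leb_ball (x : 'rV[R]_k) (r : R) : 0 < r -> leb (ball x r) = ((2 * r) ^+ k)%:E.
Proof.
move=> r0.
have vE (s : R) : box_vol (x - const_mx s) (x + const_mx s) = (2 * s) ^+ k.
  rewrite /box_vol -[X in _ ^+ X](card_ord k) -prodr_const.
  by apply: eq_bigr => i _; rewrite !mxE; ring.
apply/eqP; rewrite eq_le; apply/andP; split.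
  apply: ereal_inf_lbound; exists [set 0%N], (fun=> x - const_mx r), (fun=> x + const_mx r).
  split.
  - by move=> _ j; rewrite !mxE; lra.
  - move=> y /rV_ballP[_ xy]; exists 0%N => // i; have := xy i.
    by rewrite !mxE ltr_norml => /andP[h1 h2]; apply/andP; split; lra.
  - by rewrite esum_set1 ?vE// lee_fin exprn_ge0// mulr_ge0// ltW.
(* If the infimum were smaller, a slightly smaller closed cube, being compact, would have a finite
   cover of total volume below its own. *)
rewrite leNgt; apply/negP => hlt.
have lf : leb (ball x r) \is a fin_num.
  rewrite fin_real//; apply/andP; split; last by rewrite (lt_trans hlt)// ltry.
  apply: (@lt_le_trans _ _ 0%E) => //; apply: le_ereal_inf_tmp => _ [D [a [b [ab _ ->]]]].
  by apply: esum_ge0 => i _; rewrite lee_fin box_vol_ge0.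
rewrite -(fineK lf) lte_fin -subr_gt0 in hlt.
pose p : {poly R} := (2 *: (r%:P - 'X)) ^+ k.
have pE t : p.[t] = (2 * (r - t)) ^+ k by rewrite horner_exp !hornerE.
have [t0 t00 /(_ (Num.min t0 (r / 2)))] := horner_near0 p hlt.
set t := Num.min _ _.
have t0' : 0 < t by rewrite /t lt_min t00 divr_gt0.
have tr : t <= r / 2 by rewrite /t ge_min lexx orbT.
rewrite gtr0_norm// ge_min lexx => /(_ isT).
rewrite !pE subr0 ltr_norml => /andP[h _].
have hlt2 : (leb (ball x r) < ((2 * (r - t)) ^+ k)%:E)%E.
  by rewrite -(fineK lf) lte_fin; lra.
have sub : box (x - const_mx (r - t)) (x + const_mx (r - t)) `<=` ball x r.
  move=> y xy; apply/rV_ballP; split=> // i; have := xy i.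
  rewrite !mxE => /andP[h1 h2].
  by rewrite ltr_norml; apply/andP; split; lra.
have [l [lpos lcov lsum]] := finite_box_cover hlt2 (@box_compact _ _) sub.
have : box_vol (x - const_mx (r - t)) (x + const_mx (r - t)) <=
    \sum_(ab <- l) box_vol ab.1 ab.2.
  by apply: box_cover_vol => // i; rewrite !mxE; lra.
by rewrite vE => /le_lt_trans /(_ lsum); rewrite ltxx.
Qed.

Lemma ball_volE (r : R) : 0 < r -> @ball_vol R k r = (2 * r) ^+ k.
Proof. by move=> r0; rewrite /ball_vol leb_ball. Qed.

End boxes.

(** * Densities as counts of points in balls *)

Section counts_in_balls.
Context {R : realType} {n : nat}.
Implicit Types (A G : set 'rV[R]_n) (x y v : 'rV[R]_n) (r c : R).

Lemma ball_vol_gt0 r : 0 < r -> 0 < (2 * r) ^+ n.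
Proof. by move=> r0; rewrite exprn_gt0// mulr_gt0. Qed.

Lemma card_by_volE A r : 0 < r -> finite_set A ->
  card_by_vol A r = (card A / (2 * r) ^+ n)%:E.
Proof. by move=> r0 fA; rewrite /card_by_vol ball_volE// countingE. Qed.

(** The bridge from densities to list counts; an infinite set has density [+oo], so a finite bound
    on the density already excludes it. *)
Lemma card_by_vol_atmost A r c : 0 < r ->
  (card_by_vol A r <= c%:E)%E <-> atmost A (c * (2 * r) ^+ n).
Proof.
move=> r0; have v0 := ball_vol_gt0 r0; split => h.
  have [fA|iA] := pselect (finite_set A).
    move: h; rewrite card_by_volE// lee_fin ler_pdivrMr// => h.
    exact: atmost_le h (finite_atmost fA).
  move: h; rewrite /card_by_vol ball_volE// /counting asboolF//.
  by rewrite gt0_mulye ?leye_eq// lte_fin invr_gt0.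
rewrite card_by_volE// ?lee_fin ?ler_pdivrMr//; first exact: atmost_card.
exact: atmost_finite h.
Qed.

Lemma uniformly_discrete_sep G : uniformly_discrete G ->
  exists2 rho : R, 0 < rho & forall x y, G x -> G y ->
    (forall i, `|x ord0 i - y ord0 i| < rho) -> x = y.
Proof.
case=> rho rho0 h; exists rho => // x y Gx Gy xy.
apply: (h x rho (lexx _)); split => //; first exact: ballxx.
exact/rV_ballP.
Qed.

Lemma atmost_box G (rho : R) (a b : 'rV[R]_n) : 0 < rho ->
  (forall x y, G x -> G y -> (forall i, `|x ord0 i - y ord0 i| < rho) -> x = y) ->
  (forall i, a ord0 i <= b ord0 i) ->
  atmost (box a b `&` G) (\prod_i ((b ord0 i - a ord0 i) / rho + 1)).
Proof.
move=> rho0 sep ab s us sin.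
apply: (packing (phi := id) rho0 us ab) => [x /sin[]//|x y /sin[_ Gx] /sin[_ Gy]].
exact: sep.
Qed.

Lemma ball_box x r : ball x r `<=` box (x - const_mx r) (x + const_mx r).
Proof.
move=> y /rV_ballP[r0 h] i; have := h i; rewrite !mxE ltr_norml => /andP[h1 h2].
by apply/andP; split; lra.
Qed.

Lemma uniformly_discrete_finite G x r :
  uniformly_discrete G -> finite_set (ball x r `&` G).
Proof.
case/uniformly_discrete_sep => rho rho0 sep.
have [r0|r0] := ltP 0 r; last first.
  have -> : ball x r `&` G = set0; last exact: finite_set0.
  by apply/seteqP; split => // y [/rV_ballP[]]; rewrite ltNge r0.
have h : forall i, (x - const_mx r) ord0 i <= (x + const_mx r) ord0 i.
  by move=> i; rewrite !mxE; lra.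
apply: (@atmost_finite R _ _ _); apply: atmost_sub (atmost_box rho0 sep h).
by move=> y [/ball_box ? ?].
Qed.

Lemma translateE v G x : translate v G x <-> G (x - v).
Proof.
by split=> [[y Gy <-]|Gxv]; [rewrite addrK|exists (x - v); rewrite ?subrK].
Qed.

Lemma card_translate v G : finite_set G -> card (translate v G) = card G :> R.
Proof. by apply: card_image; exact: addIr. Qed.

End counts_in_balls.

(** * Uniform density by subdivision into cubes *)

Section subdivision_into_cubes.
Context {R : realType} {n : nat}.
Variable G : set 'rV[R]_n.
Hypothesis Gfin : forall x r, finite_set (ball x r `&` G).
Implicit Types (x y : 'rV[R]_n) (r c S : R) (q : nat).

Let N x r : R := card (ball x r `&` G).

Lemma card_ball_ge x r S q c : 0 < r -> 0 < S -> q%:R * r <= S ->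
  (forall y, c <= N y r) -> q%:R ^+ n * c <= N x S.
Proof.
move=> r0 S0 qS cN.
pose cen (f : {ffun 'I_n -> 'I_q}) : 'rV[R]_n :=
  \row_i (x ord0 i - q%:R * r + r * (2 * (f i)%:R + 1)).
have := @card_disjoint R _ {ffun 'I_n -> 'I_q} (fun f => ball (cen f) r `&` G)
  (ball x S `&` G) c (Gfin _ _).
rewrite card_ffun !card_ord natrX; apply => //.
- move=> f; apply: setSI; apply: rV_ball_sub => // i; rewrite mxE.
  have f1 : 0 <= (f i)%:R :> R by [].
  have f2 : (f i)%:R + 1 <= q%:R :> R by rewrite natr1 ler_nat.
  have := ler_wpM2l (ltW r0) f1; have := ler_wpM2l (ltW r0) f2.
  by rewrite ler_norml => h1 h2; apply/andP; split; nra.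
- move=> f f' y [/rV_ballP[_ fy] _] [/rV_ballP[_ f'y] _]; apply/ffunP => i.
  apply/val_inj/eqP => /=.
  move: (fy i) (f'y i); rewrite !mxE !ltr_norml => /andP[h1 h2] /andP[h3 h4].
  have h5 : r * (f i)%:R < r * ((f' i)%:R + 1) by nra.
  have h6 : r * (f' i)%:R < r * ((f i)%:R + 1) by nra.
  move: h5 h6; rewrite !(ltr_pM2l r0) !natr1 !ltr_nat !ltnS => h5 h6.
  by rewrite eqn_leq h5.
- by move=> f; exact: cN.
Qed.

Lemma card_ball_le x r S q c : 0 < S -> S < q%:R * r ->
  (forall y, N y r <= c) -> N x S <= q%:R ^+ n * c.
Proof.
move=> S0 qS cN.
have q0 : (0 < q)%N by rewrite lt0n; apply/eqP => q0; move: qS; rewrite q0 mul0r; lra.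
have q0R : 0 < q%:R :> R by rewrite ltr0n.
(* Open cubes of radius [s = S / q] on this grid miss their common faces; with the same centres and
   the larger radius [r] they cover. *)
have [s [s0 sr sq]] : exists s : R, [/\ 0 < s, s < r & S = s * q%:R].
  exists (S / q%:R); split; first by rewrite divr_gt0.
    by rewrite ltr_pdivrMr// mulrC.
  by rewrite divfK// gt_eqF.
have r0 : 0 < r by exact: lt_trans sr.
pose cen (f : {ffun 'I_n -> 'I_q}) : 'rV[R]_n :=
  \row_i (x ord0 i - S + s * (2 * (f i)%:R + 1)).
apply: atmost_card.
have B f : f \in enum {ffun 'I_n -> 'I_q} -> atmost (ball (cen f) r `&` G) c.
  by move=> _; apply: atmost_le (cN (cen f)) _; exact: finite_atmost.
have := atmost_bigcup B.
rewrite big_const_seq count_predT -cardE card_ffun !card_ord iter_addr_0.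
rewrite -[c *+ _]mulr_natl natrX; apply: atmost_sub => y [/rV_ballP[_ xy] Gy].
have ty i : 0 <= (y ord0 i - x ord0 i + S) / (2 * s).
  by have := xy i; rewrite ltr_norml => /andP[? ?]; rewrite divr_ge0//; lra.
have t1 i := truncn_itv (ty i).
have tq i : (Num.truncn ((y ord0 i - x ord0 i + S) / (2 * s)) < q)%N.
  rewrite -(ltr_nat R); have /andP[h1 _] := t1 i; apply: le_lt_trans h1 _.
  rewrite ltr_pdivrMr ?mulr_gt0//; have := xy i.
  by rewrite ltr_norml => /andP[? ?]; nra.
exists [ffun i => Ordinal (tq i)]; first by rewrite mem_enum.
split=> //; apply/rV_ballP; split=> // i; rewrite mxE ffunE /=.
have := t1 i; rewrite ler_pdivlMr ?mulr_gt0// ltr_pdivrMr ?mulr_gt0// -natr1.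
move=> /andP[h1 h2]; rewrite ltr_norml; apply/andP; split; nra.
Qed.

Lemma density_from_one_scale r (u e : R) : 0 < r -> 0 < e -> 0 <= u ->
  (forall x, `|N x r / (2 * r) ^+ n - u| <= e) ->
  exists2 S0 : R, 0 < S0 &
    forall S x, S0 < S -> `|N x S / (2 * S) ^+ n - u| <= 2 * e.
Proof.
move=> r0 e0 u0 hN.
have vr := ball_vol_gt0 (n := n) r0.
(* Chosen so that [(u + e) * (1 + eta) <= u + 2 * e] and, when [u >= e],
   [(u - e) * (1 - eta) >= u - 2 * e]. The factors [(1 + r / S) ^ n] and [(1 - r / S) ^ n] account
   for the incomplete layer of small cubes, and [S > r + r / d] brings them within [eta] of 1. *)
pose eta := e / (u + e + 1).
have eta0 : 0 < eta by rewrite divr_gt0//; lra.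
have etae : eta * (u + e + 1) = e by rewrite /eta divfK// gt_eqF//; lra.
pose p : {poly R} := (1 + 'X) ^+ n.
have pE t : p.[t] = (1 + t) ^+ n by rewrite horner_exp !hornerE.
have [d d0 hd] := horner_near0 p eta0.
have {}hd t : `|t| <= d -> `|(1 + t) ^+ n - 1| < eta.
  by move=> /hd; rewrite !pE addr0 expr1n.
have Nle y : N y r <= (u + e) * (2 * r) ^+ n.
  by have := hN y; rewrite ler_norml => /andP[_ h]; rewrite -ler_pdivrMr//; lra.
have Nge y : (u - e) * (2 * r) ^+ n <= N y r.
  by have := hN y; rewrite ler_norml => /andP[h _]; rewrite -ler_pdivlMr//; lra.
exists (r + r / d) => [|S x S0]; first by rewrite addr_gt0// divr_gt0.
have rd0 : 0 < r / d by rewrite divr_gt0.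
have Sr : r < S by lra.
have S_gt0 : 0 < S by lra.
have vS := ball_vol_gt0 (n := n) S_gt0.
have td : r / S <= d.
  by rewrite ler_pdivrMr// mulrC -ler_pdivrMr//; lra.
have t0 : 0 < r / S by rewrite divr_gt0.
have tS : r / S * S = r by rewrite divfK// gt_eqF.
have h1 := hd (r / S); rewrite gtr0_norm// ltr_norml in h1.
have /andP[_ {}h1] := h1 td.
have h2 := hd (- (r / S)); rewrite normrN gtr0_norm// ltr_norml in h2.
have /andP[{}h2 _] := h2 td.
pose q := Num.truncn (S / r).
have /truncn_itv /andP[q1 q2] : 0 <= S / r by rewrite divr_ge0// ltW.
rewrite -/q ler_pdivlMr// in q1; rewrite -/q ltr_pdivrMr// in q2.
have up := card_ball_le x S_gt0 q2 Nle.
have lo := card_ball_ge x r0 S_gt0 q1 Nge.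
have N0 : 0 <= N x S by rewrite /N /card.
rewrite ler_norml; apply/andP; split.
  have [ue|ue] := leP (u - e) 0.
    have : 0 <= N x S / (2 * S) ^+ n by rewrite divr_ge0// ltW.
    lra.
  suff : (u - 2 * e) <= N x S / (2 * S) ^+ n by lra.
  rewrite ler_pdivlMr//; apply: le_trans lo.
  apply: (@le_trans _ _ ((u - e) * ((1 - r / S) ^+ n * (2 * S) ^+ n))).
    rewrite mulrA ler_wpM2r ?(ltW vS)//; nra.
  rewrite [leRHS]mulrCA ler_wpM2l ?(ltW ue)// -!exprMn.
  have -> : (1 - r / S) * (2 * S) = 2 * (S - r) by rewrite -{2}tS; ring.
  by rewrite -natr1 in q2; rewrite lerXn2r ?nnegrE; nra.
suff : N x S / (2 * S) ^+ n <= u + 2 * e by lra.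
rewrite ler_pdivrMr//; apply: (le_trans up).
apply: (@le_trans _ _ ((u + e) * ((1 + r / S) ^+ n * (2 * S) ^+ n))).
  rewrite mulrCA ler_wpM2l ?addr_ge0 ?(ltW e0)// -!exprMn.
  have -> : (1 + r / S) * (2 * S) = 2 * (S + r) by rewrite -{2}tS; ring.
  have := ler0n R q; rewrite -natr1; clear -q1 r0 S_gt0 => q0.
  by rewrite lerXn2r ?nnegrE; nra.
rewrite mulrA ler_wpM2r ?(ltW vS)//; nra.
Qed.

Lemma density_from_all_scales :
  (forall e : R, 0 < e -> exists2 r, 0 < r &
     forall x y, `|N x r - N y r| <= e * (2 * r) ^+ n) ->
  exists d : R, forall e : R, 0 < e -> exists2 S0 : R, 0 < S0 &
    forall S x, S0 < S -> `|N x S / (2 * S) ^+ n - d| < e.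
Proof.
move=> hN.
have scale e : 0 < e -> exists u : R, exists2 S0 : R, 0 < S0 &
    forall S x, S0 < S -> `|N x S / (2 * S) ^+ n - u| <= e.
  move=> e0; have e20 : 0 < e / 2 by rewrite divr_gt0.
  have [r r0 h] := hN _ e20; have vr := ball_vol_gt0 (n := n) r0.
  exists (N 0 r / (2 * r) ^+ n).
  have -> : e = 2 * (e / 2) by lra.
  apply: (density_from_one_scale r0 e20) => [|x].
    by rewrite divr_ge0 ?(ltW vr)// /N /card.
  by rewrite -mulrBl normrM [X in _ * X]gtr0_norm ?invr_gt0// ler_pdivrMr.
(* The limit is not known in advance: it is the supremum of the eventual lower bounds of the
   density. A scale with error [e] around [u] puts [u - e] in [A] and bounds [A] by [u + e]. *)
pose A := [set a : R | exists2 S0 : R, 0 < S0 &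
  forall S x, S0 < S -> a <= N x S / (2 * S) ^+ n].
have Ain u S0 e : 0 < S0 ->
    (forall S x, S0 < S -> `|N x S / (2 * S) ^+ n - u| <= e) -> A (u - e).
  by move=> S00 h; exists S0 => // S x /h => /(_ x); rewrite ler_norml => /andP[? _]; lra.
have Aub u S0 e : 0 < S0 ->
    (forall S x, S0 < S -> `|N x S / (2 * S) ^+ n - u| <= e) -> ubound A (u + e).
  move=> S00 h a [S1 S10 h1].
  have ltS : S0 < S0 + S1 /\ S1 < S0 + S1 by lra.
  have := h1 _ 0 ltS.2; have := h _ 0 ltS.1; rewrite ler_norml => /andP[_ ? ?]; lra.
exists (sup A) => e e0.
have [u [S0 S00 h]] := scale (e / 3) ltac:(lra).
have ub := Aub _ _ _ S00 h.
have h1 : u - e / 3 <= sup A.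
  by apply: ub_le_sup (Ain _ _ _ S00 h); exists (u + e / 3).
have h2 : sup A <= u + e / 3.
  by apply: ge_sup => //; exists (u - e / 3); exact: Ain h.
exists S0 => // S x /h => /(_ x); rewrite ler_norml ltr_norml => /andP[? ?].
by apply/andP; split; lra.
Qed.

End subdivision_into_cubes.

Lemma weakly_almost_periodic_density {R : realType} {n : nat} (G : set 'rV[R]_n) :
  weakly_almost_periodic G -> has_uniform_density G.
Proof.
move=> [[_ ud] wap].
have fin x r : finite_set (ball x r `&` G) by exact: uniformly_discrete_finite.
have [|d hd] := density_from_all_scales fin.
  move=> e e0; have [r r0 h] := wap e e0; exists r => // x y.
  have [v /card_by_vol_atmost -/(_ r0) hv] := h x y.
  rewrite -(card_translate (- v) (fin y r)).
  apply: le_trans (atmost_card hv); apply: card_setY => //.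
  by apply: finite_image.
exists d => e e0; have [S0 S00 h] := hd e e0; exists S0 => // S x S0S.
rewrite card_by_volE// ?(lt_trans S00)// lte_fin.
exact: h.
Qed.

(** * From almost periodic to weakly almost periodic *)

Section moved_balls.
Context {R : realType} {n : nat}.
Variables (G : set 'rV[R]_n) (rho : R).
Hypothesis rho0 : 0 < rho.
Hypothesis sep : forall x y : 'rV[R]_n, G x -> G y ->
  (forall i, `|x ord0 i - y ord0 i| < rho) -> x = y.

(* A point of the first ball outside the second one lies within L of a face of
   the first ball. *)
Lemma atmost_setD_balls (L e : R) : 0 < L -> 0 < e ->
  exists2 r1 : R, 0 < r1 & forall (r : R) (x z : 'rV[R]_n), r1 <= r ->
    (forall i, `|x ord0 i - z ord0 i| <= L) ->
    atmost ((ball x r `\` ball z r) `&` G) (e * (2 * r) ^+ n).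
Proof.
(* There are [2 * n] slabs of thickness [L], one per face. Packing gives a factor [L / rho + 1]
   across a slab and [2 * r / rho + 1 <= 2 * r * K] along each other side, since [2 * r >= 1]; [M]
   gathers what multiplies [(2 * r) ^ n.-1], and [r >= M / e] absorbs it. *)
move=> L0 e0; pose K := rho^-1 + 1.
have K0 : 0 < K by rewrite addr_gt0// invr_gt0.
pose M := (2 * n)%:R * ((L / rho + 1) * K ^+ n.-1).
have Lrho : 0 < L / rho by rewrite divr_gt0.
have M0 : 0 <= M.
  by rewrite /M mulr_ge0// mulr_ge0 ?exprn_ge0 ?(ltW K0)//; lra.
exists (1 + L + M / e) => [|r x z r1r xz].
  by have : 0 <= M / e by [rewrite divr_ge0// ltW]; lra.
have Me0 : 0 <= M / e by rewrite divr_ge0// ltW.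
have r0 : 0 < r by lra.
have rM : M <= e * (2 * r).
  have : M / e <= 2 * r by lra.
  by rewrite ler_pdivrMr// mulrC.
pose lo (ib : 'I_n * bool) : 'rV[R]_n :=
  \row_j (if (j == ib.1) && ib.2 then x ord0 j + r - L else x ord0 j - r).
pose hi (ib : 'I_n * bool) : 'rV[R]_n :=
  \row_j (if (j == ib.1) && ~~ ib.2 then x ord0 j - r + L else x ord0 j + r).
have lohi ib j : lo ib ord0 j <= hi ib ord0 j.
  by case: ib => i [] /=; rewrite !mxE /= ?andbT ?andbF; case: ifP => _; lra.
have B ib : ib \in enum {: 'I_n * bool} -> atmost (box (lo ib) (hi ib) `&` G)
    ((L / rho + 1) * (2 * r * K) ^+ n.-1).
  move=> _; apply: atmost_le (atmost_box rho0 sep (lohi ib)).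
  rewrite (bigD1 ib.1)//=; apply: ler_pM.
  - by rewrite addr_ge0// divr_ge0 ?(ltW rho0)// subr_ge0.
  - by apply: prodr_ge0 => j _; rewrite addr_ge0// divr_ge0 ?(ltW rho0)// subr_ge0.
  - rewrite lerD2r ler_pM2r ?invr_gt0// !mxE eqxx /=.
    by case: (ib.2) => /=; lra.
  - rewrite -[X in _ ^+ X.-1](card_ord n) -(cardC1 ib.1) -prodr_const.
    apply: ler_prod => j ji.
    rewrite addr_ge0 ?divr_ge0 ?(ltW rho0) ?subr_ge0//= !mxE.
    rewrite (negbTE ji) /= mulrDr mulr1 lerD//; last lra.
    by rewrite ler_pM2r ?invr_gt0//; lra.
have := atmost_bigcup B.
rewrite big_const_seq count_predT -cardE card_prod card_ord card_bool iter_addr_0 => h.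
have {}h := atmost_le _ h.
apply: atmost_sub (h (e * (2 * r) ^+ n) _) => [y [[/rV_ballP[_ xy] nzy] Gy]|]; last first.
  have [n0|n0] := posnP n.
    by rewrite n0 mul0n mulr0n expr0 mulr1 ltW.
  rewrite -[in leRHS](prednK n0) exprS mulrA -[leLHS]mulr_natl exprMn.
  have := ler_wpM2r (_ : 0 <= (2 * r) ^+ n.-1) rM.
  rewrite /M exprn_ge0 ?mulr_ge0 ?(ltW r0)// => /(_ isT); apply: le_trans.
  by rewrite mulnC; lra.
have [i iP] : exists i, r <= `|z ord0 i - y ord0 i|.
  apply: contrapT => ne; apply: nzy; apply/rV_ballP; split=> // i.
  by rewrite ltNge; apply/negP => h'; apply: ne; exists i.
have yb j : x ord0 j - r <= y ord0 j <= x ord0 j + r.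
  by have := xy j; rewrite ltr_norml => /andP[? ?]; apply/andP; split; lra.
have /andP[xzi1 xzi2] : - L <= x ord0 i - z ord0 i <= L by rewrite -ler_norml.
have [zy|zy] := leP (z ord0 i) (y ord0 i).
  exists (i, true); first by rewrite mem_enum.
  split=> // j; have /andP[y1 y2] := yb j.
  rewrite !mxE /= andbF andbT; case: eqP => [->|_]; last by apply/andP.
  have /andP[y3 y4] := yb i.
  by move: iP; rewrite distrC ger0_norm ?subr_ge0// => iP; apply/andP; split; lra.
exists (i, false); first by rewrite mem_enum.
split=> // j; have /andP[y1 y2] := yb j.
rewrite !mxE /= andbF andbT; case: eqP => [->|_]; last by apply/andP.
have /andP[y3 y4] := yb i.
by move: iP; rewrite gtr0_norm ?subr_gt0// => iP; apply/andP; split; lra.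
Qed.

End moved_balls.

Lemma almost_periodic_weakly {R : realType} {n : nat} (G : set 'rV[R]_n) :
  almost_periodic_pattern G -> weakly_almost_periodic G.
Proof.
move=> [dG ap]; split=> // e e0.
have [rho rho0 sep] := uniformly_discrete_sep dG.2.
have e20 : 0 < e / 2 by rewrite divr_gt0.
have e40 : 0 < e / 4 by rewrite divr_gt0.
have [r0 r00 [L L0 dense]] := ap _ e20.
have [r1 r10 ann] := atmost_setD_balls rho0 sep L0 e40.
pose r := r0 + r1; have rpos : 0 < r by rewrite addr_gt0.
exists r => // x y.
have [w [/rV_ballP[_ wxy] /(_ r) apw]] := dense (x - y) L (lexx _).
exists (- w); apply/card_by_vol_atmost => //; rewrite opprK.
(* A mismatch has three sources: [translate w G] differs from [G] inside [ball x r], or a point of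
   [G] lies in [ball x r] outside [ball (y + w) r], or a translated point comes from [ball y r]
   outside [ball (x - w) r]. *)
have -> : e * (2 * r) ^+ n =
    e / 2 * (2 * r) ^+ n + e / 4 * (2 * r) ^+ n + e / 4 * (2 * r) ^+ n by lra.
have h1 : atmost ((translate w G `+` G) `&` ball x r) (e / 2 * (2 * r) ^+ n).
  apply/card_by_vol_atmost => //.
  apply: le_trans (ltW (apw _)); last by rewrite /r; lra.
  by apply: ereal_sup_ubound; exists x.
have h2 : atmost ((ball x r `\` ball (y + w) r) `&` G) (e / 4 * (2 * r) ^+ n).
  apply: ann => [|i]; first by rewrite /r; lra.
  by have := wxy i; rewrite !mxE opprD addrA => /ltW.
have h3 : atmost (translate w ((ball y r `\` ball (x - w) r) `&` G))
    (e / 4 * (2 * r) ^+ n).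
  apply: atmost_image; apply: ann => [|i]; first by rewrite /r; lra.
  by have := wxy i; rewrite !mxE distrC !opprB addrCA => /ltW.
apply: atmost_sub (atmostU (atmostU h1 h2) h3) => p [[[xp Gp] np]|].
  left; have [zp|nzp] := pselect (ball (y + w) r p); last by right.
  left; split=> //; right; split=> // /translateE Gpw; apply: np.
  apply/translateE; split=> //; apply/(rV_ball_translate y w).
  by rewrite subrK.
move=> [/translateE[yp Gp] np].
have [xp|nxp] := pselect (ball x r p).
  left; left; split=> //; left; split; first exact/translateE.
  by move=> Gp'; apply: np.
right; apply/translateE; split=> //; split=> // h; apply: nxp.
by move: h; rewrite rV_ball_translate.
Qed.

(** * Orthonormal frames, spans of small vectors, finite nets *)

Section row_vectors.
Context {R : realType}.

Lemma rVBE (k : nat) (u v : 'rV[R]_k) i : (u - v) ord0 i = u ord0 i - v ord0 i.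
Proof. by rewrite !mxE. Qed.

Lemma mulmx_bounded (k m : nat) (E : 'M[R]_(k, m)) :
  exists2 C : R, 0 < C & forall (u : 'rV[R]_k) (e : R), 0 <= e ->
    (forall i, `|u ord0 i| <= e) -> forall j, `|(u *m E) ord0 j| <= C * e.
Proof.
exists (1 + \sum_i \sum_j `|E i j|) => [|u e e0 ue j].
  by rewrite ltr_pwDl// sumr_ge0// => i _; rewrite sumr_ge0.
rewrite mxE; apply: le_trans (ler_norm_sum _ _ _) _.
rewrite mulrDl mul1r ler_wpDl// mulr_suml; apply: ler_sum => i _.
rewrite normrM mulrC; apply: ler_pM => //.
by rewrite (bigD1 j)//= lerDl sumr_ge0.
Qed.

(** Regularity speaks of orthonormal charts only, hence this frame. A row dependent on the others
    adds no vector, whence [k <= r] for any rank of [M]. *)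
Lemma gram_schmidt (m r : nat) (M : 'M[R]_(r, m)) :
  exists k, exists E : 'M[R]_(k, m),
    [/\ orthonormal_rows E, (M <= E)%MS & (k <= r)%N].
Proof.
elim: r M => [|r IH] M.
  by exists 0%N, M; split => //; rewrite /orthonormal_rows; apply/matrixP => -[].
pose u := @usubmx R 1 r m M.
have [k [E [oE ME kr]]] := IH (@dsubmx R 1 r m M).
have defM : M = col_mx u (@dsubmx R 1 r m M) by rewrite /u vsubmxK.
have subM k' (F : 'M[R]_(k', m)) :
    (M <= F)%MS = (u <= F)%MS && (@dsubmx R 1 r m M <= F)%MS.
  by have := @col_mx_sub R 1 r m u (@dsubmx R 1 r m M) k' F; rewrite -defM.
have [u' u'E uu'] : exists2 u' : 'rV[R]_m, u' *m E^T = 0 & u = u' + u *m E^T *m E.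
  by exists (u - u *m E^T *m E); rewrite ?subrK// mulmxBl -!mulmxA oE mulmx1 subrr.
have [u'0|u'0] := eqVneq u' 0.
  exists k, E; split; [by []| |by rewrite ltnW].
  rewrite subM ME andbT.
  by rewrite uu' u'0 add0r; exact: submxMl.
pose c := Num.sqrt ((u' *m u'^T) ord0 ord0).
have sq : (u' *m u'^T) ord0 ord0 = \sum_j u' ord0 j ^+ 2.
  by rewrite [LHS]mxE; apply: eq_bigr => j _; rewrite [X in _ * X]mxE expr2.
have c20 : 0 < (u' *m u'^T) ord0 ord0.
  rewrite lt_def sq sumr_ge0 ?andbT => [|j _]; last exact: sqr_ge0.
  apply: contraNneq u'0 => /eqP; rewrite psumr_eq0 => [/allP h|j _]; last exact: sqr_ge0.
  apply/eqP/rowP => j; apply/eqP; rewrite mxE -sqrf_eq0.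
  by apply: h; rewrite mem_index_enum.
have c0 : 0 < c by rewrite sqrtr_gt0.
exists (1 + k)%N, (col_mx (c^-1 *: u') E); split=> //.
  rewrite /orthonormal_rows tr_col_mx mul_col_row oE linearZ /=.
  have -> : E *m (c^-1 *: u'^T) = 0.
    by rewrite -scalemxAr -[E *m _]trmxK trmx_mul trmxK u'E trmx0 scaler0.
  rewrite -!scalemxAl -scalemxAr scalerA u'E scaler0 [RHS]scalar_mx_block.
  congr block_mx; apply/rowP => i; rewrite !ord1 !mxE /= -/(1%:R) mulr1n.
  have := sqr_sqrtr (ltW c20); rewrite -/c mxE => <-.
  by rewrite -expr2 -exprMn mulVf ?gt_eqF// expr1n.
rewrite subM; apply/andP; split; last first.
  by apply: submx_trans ME _; rewrite -addsmxE addsmxSr.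
have -> : u = row_mx (c%:M : 'M[R]_1) (u *m E^T) *m col_mx (c^-1 *: u') E.
  rewrite mul_row_col mul_scalar_mx scalerA divff ?gt_eqF// scale1r.
  exact: uu'.
exact: submxMl.
Qed.

(* The subspace spanned by the points of P near 0 does not depend on how near
   they are, once they are near enough; this is the k of minimal dimension. *)
Lemma span_near0 (m : nat) (P : set 'rV[R]_m) :
  exists k, exists E : 'M[R]_(k, m), orthonormal_rows E /\
    (exists2 e0 : R, 0 < e0 &
      forall p, P p -> (forall i, `|p ord0 i| < e0) -> (p <= E)%MS) /\
    (forall e : R, 0 < e -> exists M : 'M[R]_(k, m),
      [/\ forall i, P (row i M), forall i j, `|M i j| < e & (M == E)%MS]).
Proof.
pose Q k := exists E : 'M[R]_(k, m), orthonormal_rows E /\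
  exists2 e0 : R, 0 < e0 &
    forall p, P p -> (forall i, `|p ord0 i| < e0) -> (p <= E)%MS.
have exQ : exists k, `[< Q k >].
  exists m; apply/asboolP; exists 1%:M; split.
    by rewrite /orthonormal_rows trmx1 mulmx1.
  by exists 1 => // p _ _; exact: submx1.
case: (ex_minnP exQ) => k /asboolP[E [oE [e0 e00 hE]]] kmin.
exists k, E; split=> //; split; first by exists e0.
move=> e1 e10; pose e := Num.min e0 e1.
have e_gt0 : 0 < e by rewrite lt_min e00.
pose S r := exists M : 'M[R]_(r, m),
  [/\ forall i, P (row i M), forall i j, `|M i j| < e & row_free M].
have exS : exists r, `[< S r >].
  exists 0%N; apply/asboolP; exists 0; split=> [[]|[]|] //.
  by rewrite /row_free mxrank0.
have Sle r : `[< S r >] -> (r <= m)%N.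
  by move=> /asboolP[M [_ _ /eqP <-]]; exact: rank_leq_col.
(* By maximality of this independent family, every point of [P] nearer than [e] is in its span. *)
case: (ex_maxnP exS Sle) => r /asboolP[M [MP Me fM]] rmax.
have spanM p : P p -> (forall i, `|p ord0 i| < e) -> (p <= M)%MS.
  move=> Pp pe; apply/negPn/negP => pM.
  suff : (1 + r <= r)%N by rewrite ltnn.
  apply: rmax; apply/asboolP; exists (col_mx p M); split.
  - move=> i; case: (splitP i) => j ij.
      have -> : i = lshift r j by exact: val_inj.
      by rewrite rowKu row_id.
    have -> : i = rshift 1 j by exact: val_inj.
    by rewrite rowKd.
  - move=> i j; case: (splitP i) => i' ii'.
      have -> : i = lshift r i' by exact: val_inj.
      by rewrite col_mxEu ord1.
    have -> : i = rshift 1 i' by exact: val_inj.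
    by rewrite col_mxEd.
  - rewrite /row_free eqn_leq rank_leq_row /= -addsmxE.
    have : (M < p + M)%MS.
      by rewrite ltmxE addsmxSr /= addsmx_sub submx_refl andbT.
    by rewrite ltmxErank => /andP[_]; rewrite (eqP fM).
have ME : (M <= E)%MS.
  apply/row_subP => i; apply: hE => // j; rewrite mxE.
  by apply: lt_le_trans (Me i j) _; rewrite ge_min lexx.
(* [E'] competes with [E] in the minimality of [k], so [k <= k' <= r]; the [r] independent rows of
   [M] lie in the span of [E], so [r <= k]. Equality makes [M] and [E] span the same space. *)
have [k' [E' [oE' ME' k'r]]] := gram_schmidt M.
have kk' : (k <= k')%N.
  apply: kmin; apply/asboolP; exists E'; split=> //; exists e => // p Pp pe.
  exact: submx_trans (spanM p Pp pe) ME'.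
have rk : (r <= k)%N.
  by rewrite -(eqP fM); apply: leq_trans (mxrankS ME) _; exact: rank_leq_row.
have ekr : k = r by apply/eqP; rewrite eqn_leq rk (leq_trans kk').
subst r; exists M; split=> // [i j|].
  by apply: lt_le_trans (Me i j) _; rewrite ge_min lexx orbT.
apply/andP; split=> //; have [_ h] := mxrank_leqif_sup ME.
by rewrite -h (eqP fM) eqn_leq rank_leq_row -{1}(eqP fM) mxrankS.
Qed.

(** Finitely many cubes of radius [e / 2] cover the bounded region; each that meets the image of [A]
    contributes one representative, and the [option] marks those that do not. *)
Lemma finite_net (m : nat) (T : choiceType) (A : set T) (phi : T -> 'rV[R]_m)
    (K e : R) : 0 < e ->
  exists2 Y : seq T, (forall y, y \in Y -> A y) &
    forall l, A l -> (forall i, `|phi l ord0 i| <= K) ->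
      exists2 y, y \in Y & forall i, `|phi l ord0 i - phi y ord0 i| < e.
Proof.
move=> e0; have e20 : 0 < e / 2 by rewrite divr_gt0.
have := @box_compact R m (const_mx (- K)) (const_mx K).
rewrite compact_cover => /(_ _ setT (fun z : 'rV[R]_m => [set x | forall i,
  (z - const_mx (e / 2)) ord0 i < x ord0 i < (z + const_mx (e / 2)) ord0 i])).
case=> [z _|z _|F _ KF].
- exact: open_box_open.
- by exists z => // i; rewrite !mxE; apply/andP; split; lra.
have /choice[g gP] : forall z : 'rV[R]_m, exists o : option T,
    (forall y, o = Some y -> A y /\ forall i, `|phi y ord0 i - z ord0 i| < e / 2) /\
    ((exists2 y, A y & forall i, `|phi y ord0 i - z ord0 i| < e / 2) -> o <> None).
  move=> z; have [[y Ay yz]|ne] :=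
      pselect (exists2 y, A y & forall i, `|phi y ord0 i - z ord0 i| < e / 2).
    by exists (Some y); split=> // y' [<-].
  by exists None; split.
exists (pmap g F) => [y|l Al lK].
  by rewrite mem_pmap => /mapP[z _ /esym /(gP z).1[]].
have /KF[z zF lz] : box (const_mx (- K)) (const_mx K) (phi l).
  by move=> i; rewrite !mxE -ler_norml.
have lz' i : `|phi l ord0 i - z ord0 i| < e / 2.
  have := lz i; rewrite !mxE => /andP[? ?].
  by rewrite ltr_norml; apply/andP; split; lra.
have [h1 h2] := gP z.
case gz : (g z) h1 h2 => [y|] h1 h2; last by case: h2 => //; exists l.
exists y; first by rewrite mem_pmap -gz; exact: map_f.
have [_ yz] := h1 y erefl.
move=> i; move: (lz' i) (yz i); rewrite !ltr_norml => /andP[? ?] /andP[? ?].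
by apply/andP; split; lra.
Qed.

End row_vectors.

(** * Separation and density of lattice points *)

Section lattices.
Context {R : realType} {m n : nat}.
Variable L : set 'rV[R]_(m + n).
Hypothesis latL : lattice L.

Lemma latticeB l l' : L l -> L l' -> L (l - l').
Proof.
case: latL => B _ -> [z _ <-] [z' _ <-]; exists (z - z') => //.
by rewrite map_mxB mulmxBl.
Qed.

Lemma lattice0 : L 0.
Proof. by case: latL => B _ ->; exists 0 => //; rewrite map_mx0 mul0mx. Qed.

Lemma latticeN l : L l -> L (- l).
Proof. by move=> Ll; rewrite -[- l]add0r; apply: latticeB => //; exact: lattice0. Qed.

Lemma latticeD l l' : L l -> L l' -> L (l + l').
Proof. by move=> Ll Ll'; rewrite -[l']opprK; apply: latticeB => //; exact: latticeN. Qed.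

Lemma lattice_mulrz l (a : int) : L l -> L (l *~ a).
Proof.
move=> Ll; have nat_mul q : L (l *+ q).
  by elim: q => [|q IH]; [exact: lattice0|rewrite mulrS; exact: latticeD].
by case: a => q; [exact: nat_mul|apply: latticeN; exact: nat_mul].
Qed.

Lemma lattice_sum (k : nat) (f : 'I_k -> 'rV[R]_(m + n)) :
  (forall i, L (f i)) -> L (\sum_i f i).
Proof. by move=> h; apply: big_ind => //; [exact: lattice0|exact: latticeD]. Qed.

(** Integer coordinates of points this close in both projections differ by at most
    [C * (2 * C)^-1 = 1 / 2], hence agree. *)
Lemma lattice_sep : exists2 rho : R, 0 < rho & forall l l', L l -> L l' ->
  (forall i, `|lsubmx l ord0 i - lsubmx l' ord0 i| < rho) ->
  (forall i, `|rsubmx l ord0 i - rsubmx l' ord0 i| < rho) -> l = l'.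
Proof.
case: latL => B Bu ->; have [C C0 hC] := mulmx_bounded (invmx B).
exists (2 * C)^-1 => [|_ _ [z _ <-] [z' _ <-] h1 h2].
  by rewrite invr_gt0 mulr_gt0.
congr (map_mx _ _ *m _); apply/rowP => i.
set l := _ *m B in h1 h2; set l' := _ *m B in h1 h2.
have h j : `|(l - l') ord0 j| <= (2 * C)^-1.
  rewrite !mxE; case: (splitP j) => j' jj'.
    have -> : j = lshift n j' by exact: val_inj.
    by have := h1 j'; rewrite !mxE => /ltW.
  have -> : j = rshift m j' by exact: val_inj.
  by have := h2 j'; rewrite !mxE => /ltW.
have Cinv : 0 <= (2 * C)^-1 by rewrite invr_ge0 mulr_ge0// ltW.
have := hC _ _ Cinv h i.
rewrite /l /l' -mulmxBl -map_mxB mulmxK// !mxE invfM mulrCA divff ?gt_eqF// mulr1.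
rewrite -intr_norm => hz.
have : `|z ord0 i - z' ord0 i| < 1 :> int.
  by rewrite -(ltr_int R); apply: le_lt_trans hz _; lra.
by move=> hz1; suff : z ord0 i = z' ord0 i by []; move: hz1; lia.
Qed.

Lemma lattice_cobounded : exists2 K : R, 0 < K & forall v : 'rV[R]_(m + n),
  exists2 l, L l & forall i, `|l ord0 i - v ord0 i| <= K.
Proof.
case: latL => B Bu ->; have [C C0 hC] := mulmx_bounded B.
exists C => // v.
have [c cE] : exists c, v = c *m B by exists (v *m invmx B); rewrite mulmxKV.
pose z : 'rV[int]_(m + n) := \row_i Num.floor (c ord0 i).
exists (map_mx intr z *m B) => [|i]; first by exists z.
have -> : (map_mx intr z *m B) ord0 i - v ord0 i =
    ((map_mx intr z - c) *m B) ord0 i.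
  by rewrite mulmxBl -cE [RHS]mxE; congr (_ + _); rewrite mxE.
rewrite -[C]mulr1; apply: hC => // j; rewrite !mxE.
have := floor_itv (c ord0 j); rewrite intrD => /andP[h1 h2].
by rewrite ler_norml; apply/andP; split; lra.
Qed.

(** A lattice point near [(0, x)] has bounded first projection. Subtracting a net element with
    almost the same first projection makes it small and moves the second projection by at most
    [M]. *)
Lemma small_window_dense (e : R) : 0 < e ->
  exists2 r0 : R, 0 < r0 & forall (x : 'rV[R]_n) (r : R), r0 <= r ->
    exists l, [/\ L l, forall i, `|lsubmx l ord0 i| < e & ball x r (rsubmx l)].
Proof.
move=> e0; have [K K0 hK] := lattice_cobounded.
have [Y YL hY] := @finite_net R m _ L (@lsubmx R 1 m n) K e e0.
pose M := \sum_(y <- Y) \sum_i `|rsubmx y ord0 i|.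
have M0 : 0 <= M by apply: sumr_ge0 => y _; exact: sumr_ge0.
exists (K + M + 1) => [|x r rK]; first lra.
have [l Ll lK] := hK (row_mx 0 x).
have l1 i : `|lsubmx l ord0 i| <= K.
  by have := lK (lshift n i); rewrite row_mxEl !mxE subr0.
have l2 i : `|rsubmx l ord0 i - x ord0 i| <= K.
  by have := lK (rshift m i); rewrite row_mxEr !mxE.
have [y yY ly] := hY _ Ll l1.
exists (l - y); split.
- by apply: latticeB => //; exact: YL.
- by move=> i; have := ly i; rewrite !mxE.
apply/rV_ballP; split=> [|i]; first lra.
have yM : `|rsubmx y ord0 i| <= M.
  rewrite /M (big_rem y)//= (bigD1 i)//= -addrA lerDl addr_ge0//.
    by apply: sumr_ge0.
  by apply: sumr_ge0 => y' _; exact: sumr_ge0.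
have -> : rsubmx (l - y) ord0 i = rsubmx l ord0 i - rsubmx y ord0 i by rewrite !mxE.
move: (l2 i) yM; rewrite !ler_norml ltr_norml => /andP[? ?] /andP[? ?].
by apply/andP; split; lra.
Qed.

End lattices.

(** * Lattice points above a box of an affine subspace *)

Section counting_in_strips.
Context {R : realType} {m n k : nat}.
Variables (L : set 'rV[R]_(m + n)) (E : 'M[R]_(k, m)).
Hypothesis latL : lattice L.
Hypothesis oE : orthonormal_rows E.

(** The target is written in a basis of small first projections and its coordinates are rounded
    down. The error is at most [k * e1] per entry, times [C] for the return to the chart; [k + 1] in
    [e1] gives strictness and covers [k = 0]. *)
Lemma lattice_strip_dense :
  (forall e : R, 0 < e -> exists M : 'M[R]_(k, m),
     [/\ forall i, exists2 l, L l & lsubmx l = row i M,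
         forall i j, `|M i j| < e & (M == E)%MS]) ->
  forall (e : R) (t : 'rV[R]_k), 0 < e ->
  exists l, exists s : 'rV[R]_k,
    [/\ L l, lsubmx l = s *m E & forall i, `|s ord0 i - t ord0 i| < e].
Proof.
move=> hM e t e0; have [C C0 hC] := mulmx_bounded E^T.
pose e1 := e / (C * (k%:R + 1)).
have k1 : 0 < k%:R + 1 :> R by rewrite ltr_wpDl.
have e10 : 0 < e1 by rewrite divr_gt0// mulr_gt0.
have [M [ML Me /andP[ME EM]]] := hM _ e10.
have /choice[f fP] : forall i, exists l, L l /\ lsubmx l = row i M.
  by move=> i; have [l] := ML i; exists l.
have /submxP[c cM] : (t *m E <= M)%MS by apply: submx_trans EM; exact: submxMl.
pose z := \row_i (Num.floor (c ord0 i))%:~R : 'rV[R]_k.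
pose l := \sum_i f i *~ Num.floor (c ord0 i).
have Ll : L l by apply: lattice_sum => // i; apply: lattice_mulrz => //; exact: (fP i).1.
have pl : lsubmx l = z *m M.
  rewrite /l linear_sum /= mulmx_sum_row; apply: eq_bigr => i _.
  by rewrite raddfMz /= (fP i).2 mxE -scaler_int.
have /submxP[s sE] : (z *m M <= E)%MS by apply: submx_trans ME; exact: submxMl.
exists l, s; split=> // [|i]; first by rewrite pl.
have sEt : s = z *m M *m E^T by rewrite sE -mulmxA oE mulmx1.
have tEt : t = c *m M *m E^T by rewrite -cM -mulmxA oE mulmx1.
have -> : s ord0 i - t ord0 i = ((z - c) *m M *m E^T) ord0 i.
  by rewrite 2!mulmxBl -sEt -tEt [RHS]mxE; congr (_ + _); rewrite mxE.
apply: (@le_lt_trans _ _ (C * (k%:R * e1))).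
  apply: hC => [|j]; first by rewrite mulr_ge0// ltW.
  rewrite mxE; apply: le_trans (ler_norm_sum _ _ _) _.
  have -> : k%:R * e1 = \sum_(i < k) e1 by rewrite sumr_const card_ord mulr_natl.
  apply: ler_sum => i' _; rewrite normrM -[leRHS]mul1r; apply: ler_pM => //.
    rewrite !mxE; have := floor_itv (c ord0 i'); rewrite intrD => /andP[h1 h2].
    by rewrite ler_norml; apply/andP; split; lra.
  exact: ltW.
have -> : e = C * ((k%:R + 1) * e1).
  by rewrite /e1; field; rewrite !gt_eqF.
by rewrite ltr_pM2l// ltr_pM2r// ltrDl.
Qed.

Hypothesis dense : forall (e : R) (t : 'rV[R]_k), 0 < e ->
  exists l, exists s : 'rV[R]_k,
    [/\ L l, lsubmx l = s *m E & forall i, `|s ord0 i - t ord0 i| < e].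

(* The strip has many disjoint translates by lattice vectors inside a strip of
   bounded width, whose lattice points are counted by packing. *)
Lemma atmost_strip : exists2 C : R, 0 < C &
  forall (a : 'rV[R]_m) (c d : 'rV[R]_k), (forall i, c ord0 i < d ord0 i) ->
  exists2 r0 : R, 0 < r0 & forall (r : R) (x : 'rV[R]_n), r0 <= r ->
    atmost [set l | [/\ L l, exists2 t, box c d t & lsubmx l = affine_chart a E t
                       & ball x r (rsubmx l)]]
      (C * box_vol c d * (2 * r) ^+ n).
Proof.
have [rho rho0 sep] := lattice_sep latL.
have [CE CE0 hCE] := mulmx_bounded E.
(* Chart coordinates closer than [rho'] give first projections closer than [rho], because [E]
   enlarges by at most [CE]. *)
pose rho' := rho / (CE + 1).
have rho'0 : 0 < rho' by rewrite divr_gt0//; lra.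
have rhoE : rho = rho' * (CE + 1) by rewrite /rho' divfK// gt_eqF//; lra.
pose C1 := 4 / rho' + 2.
have rV0 : 0 < rho'^-1 by rewrite invr_gt0.
have C10 : 0 < C1 by rewrite /C1; lra.
exists (C1 ^+ k * C1 ^+ n) => [|a c d cd]; first by rewrite mulr_gt0// exprn_gt0.
have [w wE] : exists w : 'I_k -> R, forall j, w j = d ord0 j - c ord0 j.
  by exists (fun j => d ord0 j - c ord0 j).
have w0 j : 0 < w j by rewrite wE subr_gt0.
(* Number of translates along axis [j], at spacing [2 * w j]: by [q1] they spread over length at
   most 1, and by [q2] the count is at least [1 / (2 * w j)]. The latter turns the bounded total
   into a bound proportional to the volume. *)
pose q j := (Num.truncn (2 * w j)^-1).+1.
have q1 j : (q j).-1%:R * (2 * w j) <= 1.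
  have : 0 <= (2 * w j)^-1 by rewrite invr_ge0 mulr_ge0// ltW.
  move=> /truncn_itv /andP[h _].
  by rewrite -ler_pdivlMr ?mulr_gt0// mul1r.
have q2 j : 1 <= (q j)%:R * (2 * w j).
  have : 0 <= (2 * w j)^-1 by rewrite invr_ge0 mulr_ge0// ltW.
  move=> /truncn_itv /andP[_ h].
  by rewrite -ler_pdivrMr ?mulr_gt0// mul1r ltW.
have q3 j : 1 <= (q j)%:R :> R by rewrite ler1n.
pose I := {dffun forall j : 'I_k, 'I_(q j)}.
have [e e0 ew] : exists2 e : R, 0 < e & forall j, e <= w j / 4.
  exists (1 + \sum_j (4 / w j))^-1 => [|j].
    by rewrite invr_gt0 ltr_pwDl// sumr_ge0// => j _; rewrite divr_ge0// ltW.
  rewrite -[leRHS]invrK lef_pV2 ?posrE ?invr_gt0 ?divr_gt0//; last first.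
    by rewrite ltr_pwDl// sumr_ge0// => i _; rewrite divr_ge0// ltW.
  rewrite invf_div (bigD1 j)//= addrCA lerDl addr_ge0// sumr_ge0// => i _.
  by rewrite divr_ge0// ltW.
(* The ideal grid translates are only approximated, within [e <= w j / 4]; two boxes of side [w j]
   at spacing about [2 * w j] still stay disjoint. *)
have /choice[g gP] : forall f : I, exists ls : 'rV[R]_(m + n) * 'rV[R]_k,
    [/\ L ls.1, lsubmx ls.1 = ls.2 *m E &
      forall j, `|ls.2 ord0 j - 2 * w j * (f j)%:R| < e].
  move=> f; have [l [s [Ll ls st]]] := dense (\row_j (2 * w j * (f j)%:R)) e0.
  by exists (l, s); split=> // j; have := st j; rewrite mxE.
pose N := \sum_f \sum_i `|rsubmx (g f).1 ord0 i|.
have N0 : 0 <= N by apply: sumr_ge0 => f _; exact: sumr_ge0.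
have gN f i : `|rsubmx (g f).1 ord0 i| <= N.
  rewrite /N (bigD1 f)//= (bigD1 i)//= -addrA lerDl addr_ge0//.
    exact: sumr_ge0.
  by apply: sumr_ge0 => f' _; exact: sumr_ge0.
(* [N] bounds how far the translates move second projections, so all of them stay in a ball of
   radius [r + N <= 2 * r]. *)
exists (N + 1) => [|r x rN s us sP]; first lra.
have r0 : 0 < r by lra.
have [T TE] : exists T : 'rV[R]_(m + n) -> 'rV[R]_k,
    forall l t, lsubmx l = affine_chart a E t -> T l = t.
  exists (fun l => (lsubmx l - a) *m E^T) => l t ->.
  by rewrite /affine_chart addrC addKr -mulmxA oE mulmx1.
have sT l : l \in s -> box c d (T l) /\ lsubmx l = affine_chart a E (T l).
  by move=> /sP[_ [t tb e1] _]; rewrite (TE _ _ e1).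
pose S := [seq l + (g f).1 | f <- enum I, l <- s].
have chartD l f : l \in s ->
    lsubmx (l + (g f).1) = affine_chart a E (T l + (g f).2).
  move=> ls; have [_ e1] := sT l ls; have [_ e2 _] := gP f.
  by rewrite linearD /= e1 e2 /affine_chart mulmxDl addrA.
have TS l f : l \in s -> T (l + (g f).1) = T l + (g f).2.
  by move=> /chartD h; apply: TE; exact: h.
have uS : uniq S.
  apply: allpairs_uniq => //; first exact: enum_uniq.
  move=> [f l] [f' l'] /allpairsP[[f1 l1] [_ ls [-> ->]]].
  move=> /allpairsP[[f2 l2] [_ ls' [-> ->]]] /= ell.
  have eT : T l1 + (g f1).2 = T l2 + (g f2).2 by rewrite -!TS// ell.
  have ff : f1 = f2.
    apply/ffunP => j; apply/val_inj/eqP => /=.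
    have := congr1 (fun v : 'rV[R]_k => v ord0 j) eT.
    rewrite mxE [in RHS]mxE => eTj.
    have [/(_ j)/andP[b1 b2] _] := sT _ ls.
    have [/(_ j)/andP[b3 b4] _] := sT _ ls'.
    have [_ _ /(_ j)] := gP f1; have [_ _ /(_ j)] := gP f2.
    rewrite !ltr_norml => /andP[s1 s2] /andP[s3 s4].
    have := ew j; have := w0 j; have := wE j => w3 w1 w2.
    have h5 : w j * (f1 j)%:R < w j * ((f2 j)%:R + 1) by lra.
    have h6 : w j * (f2 j)%:R < w j * ((f1 j)%:R + 1) by lra.
    move: h5 h6; rewrite !(ltr_pM2l (w0 j)) !natr1 !ltr_nat !ltnS => h5 h6.
    by rewrite eqn_leq h5.
  by move: ell; rewrite ff => /addIr ->.
pose lo := row_mx (\row_j (c ord0 j - w j / 4)) (x - const_mx (r + N)).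
pose hi := row_mx (\row_j (d ord0 j + 1 + w j / 4)) (x + const_mx (r + N)).
pose phi l := row_mx (T l) (rsubmx l).
have lohi i : lo ord0 i <= hi ord0 i.
  rewrite /lo /hi; case: (splitP i) => j ij.
    have -> : i = lshift n j by exact: val_inj.
    by rewrite !row_mxEl !mxE; have := w0 j; have := cd j; lra.
  have -> : i = rshift k j by exact: val_inj.
  by rewrite !row_mxEr !mxE; lra.
have loE j : lo ord0 (lshift n j) = c ord0 j - w j / 4 by rewrite row_mxEl mxE.
have hiE j : hi ord0 (lshift n j) = d ord0 j + 1 + w j / 4 by rewrite row_mxEl mxE.
have loE' j : lo ord0 (rshift k j) = x ord0 j - (r + N) by rewrite row_mxEr !mxE.
have hiE' j : hi ord0 (rshift k j) = x ord0 j + (r + N) by rewrite row_mxEr !mxE.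
have pos i : 0 <= (hi ord0 i - lo ord0 i) / rho' + 1.
  by rewrite addr_ge0// divr_ge0 ?(ltW rho'0)// subr_ge0.
have Sbox l : l \in S -> box lo hi (phi l).
  move=> /allpairsP[[f l'] [_ /= ls ->]] i.
  rewrite /phi; case: (splitP i) => j ij.
    have -> : i = lshift n j by exact: val_inj.
    rewrite loE hiE row_mxEl TS// mxE.
    have [/(_ j)/andP[b1 b2] _] := sT _ ls.
    have [_ _ /(_ j)] := gP f; rewrite ltr_norml => /andP[s1 s2].
    have := ew j; have := w0 j => w1 w2.
    have f0 : 0 <= (f j)%:R * (2 * w j) by rewrite mulr_ge0// mulr_ge0// ltW.
    have f1 : (f j)%:R * (2 * w j) <= 1.
      apply: le_trans (q1 j); rewrite ler_wpM2r ?mulr_ge0 ?(ltW w1)//.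
      by rewrite ler_nat -ltnS prednK.
    by apply/andP; split; lra.
  have -> : i = rshift k j by exact: val_inj.
  rewrite loE' hiE' row_mxEr.
  have -> : rsubmx (l' + (g f).1) ord0 j = rsubmx l' ord0 j + rsubmx (g f).1 ord0 j.
    by rewrite !mxE.
  have [_ _ /rV_ballP[_ /(_ j)]] := sP _ ls.
  have := gN f j; rewrite ler_norml ltr_norml => /andP[? ?] /andP[? ?].
  by apply/andP; split; lra.
have SL l : l \in S -> L l /\ lsubmx l = affine_chart a E (T l).
  move=> /allpairsP[[f l'] [_ /= ls ->]]; rewrite TS// chartD//; split=> //.
  have [Ll _ _] := sP _ ls; have [Lg _ _] := gP f.
  exact: (latticeD latL).
have Ssep l l' : l \in S -> l' \in S ->
    (forall i, `|phi l ord0 i - phi l' ord0 i| < rho') -> l = l'.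
  move=> /SL[Ll el] /SL[Ll' el'] h; apply: sep => // i; last first.
    have := h (rshift k i); rewrite /phi !row_mxEr => /lt_le_trans; apply.
    by rewrite rhoE ler_pMr//; lra.
  have hT j : `|(T l - T l') ord0 j| <= rho'.
    by have := h (lshift n j); rewrite /phi !row_mxEl => /ltW; rewrite rVBE.
  have := hCE _ _ (ltW rho'0) hT i.
  have -> : ((T l - T l') *m E) ord0 i = lsubmx l ord0 i - lsubmx l' ord0 i.
    rewrite el el' /affine_chart mulmxBl.
    by rewrite -!rVBE opprD addrACA subrr add0r.
  by move=> /le_lt_trans; apply; rewrite rhoE; lra.
have := packing rho'0 uS lohi Sbox Ssep.
rewrite size_allpairs -cardE card_dffun_ord big_split_ord /= natrM natr_prod.
have q0 : 0 < \prod_i (q i)%:R :> R.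
  by apply: prodr_gt0 => j _; rewrite (lt_le_trans ltr01).
rewrite mulrC -ler_pdivlMr// => /le_trans; apply.
rewrite ler_pdivrMr//.
have -> : C1 ^+ k * C1 ^+ n * box_vol c d * (2 * r) ^+ n * \prod_i (q i)%:R =
    (C1 ^+ k * (box_vol c d * \prod_i (q i)%:R)) * (C1 * (2 * r)) ^+ n.
  rewrite [(C1 * (2 * r)) ^+ n]exprMn.
  by move: (C1 ^+ k) (C1 ^+ n) (box_vol c d) (_ ^+ n) (\prod_i _) => *; ring.
apply: ler_pM.
- by apply: prodr_ge0 => i _; exact: pos.
- by apply: prodr_ge0 => i _; exact: pos.
- rewrite -big_split /= -[X in _ ^+ X](card_ord k) -prodr_const -big_split /=.
  apply: ler_prod => j _; rewrite pos /=.
  rewrite loE hiE -wE; have := wE j; have := w0 j; have := q2 j; have := q3 j.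
  move=> q3j q2j w0j wEj.
  have -> : d ord0 j + 1 + w j / 4 - (c ord0 j - w j / 4) = 3 / 2 * w j + 1 by lra.
  have h1 : w j <= w j * (q j)%:R by rewrite ler_peMr// ltW.
  have h2 : 3 / 2 * w j + 1 <= 4 * (w j * (q j)%:R) by lra.
  have h3 := ler_wpM2r (ltW rV0) h2.
  by rewrite /C1; lra.
- rewrite -[X in _ ^+ X](card_ord n) -prodr_const.
  apply: ler_prod => j _; rewrite pos /=.
  rewrite loE' hiE'.
  have h2 : x ord0 j + (r + N) - (x ord0 j - (r + N)) <= 4 * (2 * r) by lra.
  have h3 := ler_wpM2r (ltW rV0) h2.
  by rewrite /C1; lra.
Qed.

End counting_in_strips.

(** * Boundaries of regular windows *)

Section boundaries.
Context {R : realType} {m : nat}.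
Implicit Types (W S A : set 'rV[R]_m).

(* The total volume of all but finitely many boxes of a cover is less than the
   volume of one ball, so no ball avoids these finitely many boxes. *)
Lemma leb_finite_balls_bounded A S (e : R) : (leb A < +oo)%E -> 0 < e ->
  (forall s, S s -> ball s e `<=` A) ->
  exists K : R, forall s, S s -> forall i, `|s ord0 i| <= K.
Proof.
move=> /ereal_inf_lt[v [D [a [b [ab AD ->]]]] vfin] e0 SA.
pose f i := (box_vol (a i) (b i))%:E.
have f0 i : (0 <= f i)%E by rewrite lee_fin box_vol_ge0.
have fE : (\esum_(i in D) f i)%E \is a fin_num.
  by rewrite ge0_fin_numE// esum_ge0.
have v0 : 0 < (2 * e) ^+ m by rewrite exprn_gt0// mulr_gt0.
have [_ [X [fX XD] <-]] := ub_ereal_sup_adherent v0 fE.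
rewrite -esum_fset// => hX.
have tail : (\esum_(i in D `&` ~` X) f i < ((2 * e) ^+ m)%:E)%E.
  have := @esumID R _ X D f (fun i _ => f0 i).
  rewrite setIidr// => E.
  have fX' : (\esum_(i in X) f i)%E \is a fin_num.
    rewrite ge0_fin_numE ?esum_ge0//; apply: le_lt_trans vfin.
    by rewrite -/f E leeDl// esum_ge0.
  have fX'' : (\esum_(i in D `&` ~` X) f i)%E \is a fin_num.
    rewrite ge0_fin_numE ?esum_ge0//; apply: le_lt_trans vfin.
    by rewrite -/f E leeDr// esum_ge0.
  have : (\esum_(i in D) f i - ((2 * e) ^+ m)%:E < \esum_(i in X) f i)%E by exact: hX.
  rewrite E; move: (esum X f) (esum (D `&` ~` X) f) fX' fX'' => [x| |] [y| |] //= _ _.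
  by rewrite -!EFinD !lte_fin; lra.
pose N := \sum_(i <- fset_set X) \sum_j (`|a i ord0 j| + `|b i ord0 j|).
have N0 : 0 <= N by apply: sumr_ge0 => i _; apply: sumr_ge0 => j _; rewrite addr_ge0.
have XN i j : X i -> `|a i ord0 j| + `|b i ord0 j| <= N.
  move=> Xi; rewrite /N (big_fsetD1 i) /=; last by rewrite in_fset_set// mem_set.
  rewrite (bigD1 j)//= -addrA lerDl addr_ge0//.
    by apply: sumr_ge0 => *; rewrite addr_ge0.
  by apply: sumr_ge0 => ? _; apply: sumr_ge0 => *; rewrite addr_ge0.
exists (N + e) => s Ss i; rewrite leNgt; apply/negP => si.
suff : (leb (ball s e) < ((2 * e) ^+ m)%:E)%E by rewrite leb_ball// ltxx.
apply: le_lt_trans tail; apply: ereal_inf_lbound.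
exists (D `&` ~` X), a, b; split=> // y sy.
have [j Dj yj] := AD _ (SA _ Ss _ sy).
exists j => //; split=> // Xj.
have /rV_ballP[_ /(_ i)] := sy; have /andP[y1 y2] := yj i.
have := XN _ i Xj.
have := ler_norm (b j ord0 i); have := ler_norm (- a j ord0 i).
rewrite normrN ltr_norml => h1 h2 h3 /andP[h4 h5].
have a0 := normr_ge0 (a j ord0 i); have b0 := normr_ge0 (b j ord0 i).
have : `|s ord0 i| <= N + e by rewrite ler_norml; apply/andP; split; lra.
by rewrite leNgt si.
Qed.

Lemma affine_chartP {k} (a : 'rV[R]_m) (E : 'M[R]_(k, m)) (t : 'rV[R]_k) :
  orthonormal_rows E -> (affine_chart a E t - a) *m E^T = t.
Proof. by move=> oE; rewrite /affine_chart addrC addKr -mulmxA oE mulmx1. Qed.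

Lemma affine_subspace_recenter {k} (a b : 'rV[R]_m) (E : 'M[R]_(k, m)) :
  (b - a <= E)%MS -> affine_subspace a E = affine_subspace b E.
Proof.
move=> /submxP[c cE]; apply/seteqP; split=> _ [t _ <-].
  exists (t - c) => //; rewrite /affine_chart mulmxBl -cE opprB addrA.
  by rewrite [b + _]addrC -addrA [b + _]addrC subrK addrC.
exists (c + t) => //; rewrite /affine_chart mulmxDl -cE addrA.
by rewrite [a + _]addrC subrK.
Qed.

Lemma regular_window_small W {k} (a : 'rV[R]_m) (E : 'M[R]_(k, m)) (d : R) :
  regular_window W -> orthonormal_rows E -> 0 < d ->
  exists2 e : R, 0 < e &
    let V := affine_subspace a E in
    (affine_leb a E (rel_thickening V (rel_boundary V W) e) < d%:E)%E.
Proof.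
move=> rW oE d0; have := rW k a E oE => /= h.
have hd : nbhs (0 : \bar R)%E [set y | (y < d%:E)%E].
  by apply: open_nbhs_nbhs; split; [exact: open_ereal_lt_ereal|rewrite /= lte_fin].
have h1 := h _ hd.
have h2 : \forall e \near (0 : R)^'+, 0 < e by exact: nbhs_right_gt.
have [e [e0 he]] := filter_ex (filterI h2 h1).
by exists e.
Qed.

(** Regularity is applied to the whole space: some thickening of the boundary has finite volume and
    contains a ball of fixed radius around each boundary point. *)
Lemma regular_window_boundary_bounded W : regular_window W ->
  exists K : R, forall s, (closure W `&` closure (~` W)) s -> forall i, `|s ord0 i| <= K.
Proof.
move=> rW; have o1 : orthonormal_rows (1%:M : 'M[R]_m).
  by rewrite /orthonormal_rows trmx1 mulmx1.
have [e e0 /=] := regular_window_small 0 rW o1 ltr01.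
have cE t : affine_chart 0 (1%:M : 'M[R]_m) t = t by rewrite /affine_chart add0r mulmx1.
have -> : affine_subspace 0 (1%:M : 'M[R]_m) = setT.
  by apply/seteqP; split=> // x _; exists x.
rewrite /affine_leb => h.
apply: (leb_finite_balls_bounded (lt_trans h (ltry _)) e0) => s ss y sy.
rewrite /rel_thickening /preimage /= cE; split=> //; exists s => //.
by rewrite /rel_boundary setTI setTI setTD.
Qed.

Lemma line_continuous (u v : 'rV[R]_m) : continuous (fun t : R => u + t *: v).
Proof.
move=> t; apply/cvg_ballP => e e0.
pose C := 1 + \sum_i `|v ord0 i|.
have C0 : 0 < C by rewrite ltr_pwDl// sumr_ge0.
have eC : 0 < e / C by rewrite divr_gt0.
apply: filterS (nbhsx_ballx t (e / C) eC) => t'; rewrite /ball /= => tt'.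
apply/rV_ballP; split=> // i; rewrite !mxE opprD addrACA subrr add0r -mulrBl normrM.
apply: (@le_lt_trans _ _ (`|t - t'| * C)); last by rewrite -ltr_pdivlMr.
rewrite ler_wpM2l// /C (bigD1 i)//= addrCA lerDl addr_ge0//; exact: sumr_ge0.
Qed.

Lemma segment_meets_boundary W {k} (a y y' : 'rV[R]_m) (E : 'M[R]_(k, m)) :
  let V := affine_subspace a E in
  V y -> V y' -> W y -> ~ W y' ->
  exists2 s, rel_boundary V W s & forall i,
    `|y ord0 i - s ord0 i| <= `|y ord0 i - y' ord0 i| /\
    `|y' ord0 i - s ord0 i| <= `|y ord0 i - y' ord0 i|.
Proof.
move=> V Vy Vy' Wy nWy'; pose f (t : R) := y + t *: (y' - y).
have cf : continuous f by exact: line_continuous.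
have f0 : f 0 = y by rewrite /f scale0r addr0.
have f1 : f 1 = y' by rewrite /f scale1r addrC subrK.
have Vf t : V (f t).
  case: Vy Vy' => u _ uy [u' _ u'y]; exists (u + t *: (u' - u)) => //.
  rewrite /f -uy -u'y /affine_chart mulmxDl -scalemxAl mulmxBl addrA.
  by rewrite opprD addrACA subrr add0r.
pose A := f @^-1` closure (V `&` W); pose B := f @^-1` closure (V `\` W).
have cA : closed A by apply: (preimage_closed _ (@closed_closure _ _)) => t _; exact: cf.
have cB : closed B by apply: (preimage_closed _ (@closed_closure _ _)) => t _; exact: cf.
have AB t : A t \/ B t.
  have [Wt|nWt] := pselect (W (f t)); [left|right]; exact: subset_closure.
have [[t [t01 [At Bt]]]|ne] := pselect (exists t : R, `[0, 1]%classic t /\ A t /\ B t).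
  move: t01; rewrite /= in_itv /= => /andP[t0 t1].
  exists (f t); first by split.
  move=> i; rewrite !mxE; split.
    have -> : y ord0 i - (y ord0 i + t * (y' ord0 i - y ord0 i)) =
      t * (y ord0 i - y' ord0 i) by ring.
    by rewrite normrM ger0_norm// ler_piMl.
  have -> : y' ord0 i - (y ord0 i + t * (y' ord0 i - y ord0 i)) =
    (t - 1) * (y ord0 i - y' ord0 i) by ring.
  by rewrite normrM ler_piMl// ler_norml; apply/andP; split; lra.
(* If the closed sets [A] and [B], which cover the line, do not meet on the segment, then [A] is
   also open there. It contains 0, so by connectedness it contains 1, which lies in [B]. *)
have h : `[0, 1]%classic `&` A = `[0, 1]%classic.
  apply: (@segment_connected R 0 1).
  - exists 0; split; first by rewrite /= in_itv /= lexx ler01.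
    by rewrite /A /preimage /= f0; apply: subset_closure.
  - exists (~` B); first exact: closed_openC.
    apply/seteqP; split=> t [t01 ht]; split=> //.
      by move=> Bt; apply: ne; exists t.
    by case: (AB t).
  - by exists A.
case: ne; exists 1.
have I1 : `[0, 1]%classic (1 : R) by rewrite /= in_itv /= lexx ler01.
split=> //; split; first by move: I1; rewrite -h => -[].
by rewrite /B /preimage /= f1; apply: subset_closure.
Qed.

Lemma rel_boundary_sub W (V : set 'rV[R]_m) :
  rel_boundary V W `<=` closure W `&` closure (~` W).
Proof.
move=> s [_ [s1 s2]]; split; first by move: s1; apply: closureS => x [].
by move: s2; apply: closureS => x [].
Qed.

(* The closure of a thickening is a compact part of a larger thickening. *)
Lemma regular_window_cover W {k} (a : 'rV[R]_m) (E : 'M[R]_(k, m)) (d : R) :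
  regular_window W -> orthonormal_rows E -> 0 < d ->
  let V := affine_subspace a E in
  exists2 e : R, 0 < e & exists l : seq ('rV[R]_k * 'rV[R]_k),
    [/\ forall cd, cd \in l -> forall i, cd.1 ord0 i < cd.2 ord0 i,
        rel_thickening V (rel_boundary V W) e `<=` [set y | exists2 cd, cd \in l &
          exists2 t, box cd.1 cd.2 t & y = affine_chart a E t]
      & \sum_(cd <- l) box_vol cd.1 cd.2 < d].
Proof.
move=> rW oE d0 V.
have [e e0 he] := regular_window_small a rW oE d0.
have [K hK] := regular_window_boundary_bounded rW.
have [CE CE0 hCE] := mulmx_bounded E; have [CT CT0 hCT] := mulmx_bounded E^T.
have e20 : 0 < e / 2 by rewrite divr_gt0.
pose S := affine_chart a E @^-1` rel_thickening V (rel_boundary V W) (e / 2).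
pose S' := affine_chart a E @^-1` rel_thickening V (rel_boundary V W) e.
have clS t (r : R) : closure S t -> 0 < r ->
    exists2 t', S t' & forall i, `|t ord0 i - t' ord0 i| < r.
  move=> ct r0; have [t' [St' /rV_ballP[_ tt']]] := ct _ (nbhsx_ballx t r r0).
  by exists t'.
pose K' := `|K| + e + \sum_i `|a ord0 i|.
have K'0 : 0 <= K' by rewrite addr_ge0 ?sumr_ge0// addr_ge0// ltW.
have Sb t : S t -> forall i, `|t ord0 i| <= CT * K'.
  move=> [_ [s /rel_boundary_sub/hK sK /rV_ballP[_ st]]] i.
  rewrite -(affine_chartP a t oE); apply: hCT => // j; rewrite rVBE.
  have aj : `|a ord0 j| <= \sum_i `|a ord0 i| by rewrite (bigD1 j)//= lerDl sumr_ge0.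
  move: (sK j) (st j) aj; have := ler_norm K.
  rewrite /K' !ler_norml ltr_norml => hKK /andP[? ?] /andP[? ?] /andP[? ?].
  by apply/andP; split; lra.
have cS : compact (closure S).
  apply: (subclosed_compact (@closed_closure _ S)
    (@box_compact _ _ (const_mx (- (CT * K' + 1))) (const_mx (CT * K' + 1)))) => t ct i.
  have [t' St' tt'] := clS t 1 ct ltr01.
  move: (Sb _ St' i) (tt' i); rewrite ler_norml ltr_norml !mxE.
  by move=> /andP[? ?] /andP[? ?]; apply/andP; split; lra.
have SS' : closure S `<=` S'.
  (* A chart displacement of this size moves the point by less than [e / 2], the margin between the
     two thickenings. *)
  move=> t ct; have eC : 0 < e / 2 / (CE + 1) by rewrite divr_gt0//; lra.
  have [t' [_ [s sb /rV_ballP[_ st]]] tt'] := clS t _ ct eC.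
  split; first by exists t.
  exists s => //; apply/rV_ballP; split=> // i.
  have h j : `|(t - t') ord0 j| <= e / 2 / (CE + 1) by rewrite rVBE ltW.
  have e2 : e / 2 / (CE + 1) * (CE + 1) = e / 2 by rewrite divfK// gt_eqF//; lra.
  have hB : `|((t - t') *m E) ord0 i| < e / 2.
    by apply: le_lt_trans (hCE _ _ (ltW eC) h i) _; rewrite -[ltRHS]e2; lra.
  have -> : affine_chart a E t = affine_chart a E t' + (t - t') *m E.
    by rewrite /affine_chart -addrA -mulmxDl [t' + _]addrC subrK.
  move: (st i) hB; rewrite [X in _ -> _ -> `|_ - X| < _]mxE !ltr_norml.
  by move=> /andP[? ?] /andP[? ?]; apply/andP; split; lra.
have [l [lpos lcov lsum]] := finite_box_cover he cS SS'.
exists (e / 2) => //; exists l; split=> // y Sy.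
have [t _ yt] := Sy.1; rewrite -yt in Sy *.
have /lcov[cd cdl tcd] : closure S t by apply: subset_closure.
by exists cd => //; exists t.
Qed.

End boundaries.

Lemma rel_thickening_mono {R : realType} {m : nat} (V S : set 'rV[R]_m) (e e' : R) :
  e <= e' -> rel_thickening V S e `<=` rel_thickening V S e'.
Proof.
move=> ee y [Vy [s Ss /rV_ballP[e0 sy]]]; split=> //; exists s => //.
by apply/rV_ballP; split=> [|i]; [exact: lt_le_trans ee|exact: lt_le_trans ee].
Qed.

Lemma common_lower_bound {R : realType} (T : eqType) (Y : seq T) (f : T -> R) :
  (forall y, 0 < f y) -> exists2 e : R, 0 < e & forall y, y \in Y -> e <= f y.
Proof.
move=> f0; elim: Y => [|y Y [e e0 IH]]; first by exists 1.
exists (Num.min e (f y)) => [|z]; first by rewrite lt_min e0 f0.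
by rewrite inE => /orP[/eqP->|/IH ez]; rewrite ge_min ?lexx ?orbT// ez.
Qed.

(** * Almost periods of model sets *)

Section model_sets.
Context {R : realType} {m n : nat}.
Variables (L : set 'rV[R]_(m + n)) (W : set 'rV[R]_m).
Hypotheses (latL : lattice L) (rW : regular_window W).

(* The points of the model set gained or lost in a translation by rsubmx l lift
   to lattice points whose first projections are close to the boundary of W. *)
Lemma model_set_translate l : L l ->
  translate (rsubmx l) (model_set L W) `+` model_set L W `<=`
  @rsubmx R 1 m n @` [set x | L x /\
    ((W (lsubmx x) /\ ~ W (lsubmx x - lsubmx l)) \/
     (~ W (lsubmx x) /\ W (lsubmx x - lsubmx l)))].
Proof.
move=> Ll p [[[_ [x [Lx /= Wx] <-] <-] np]|[[x [Lx /= Wx] <-] np]].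
  exists (x + l); last by rewrite linearD.
  split; first exact: latticeD.
  right; split; last by rewrite linearD addrK.
  move=> W'; apply: np; exists (x + l); last by rewrite linearD.
  by split=> //; exact: latticeD.
exists x => //; split=> //; left; split=> // W'; apply: np.
apply/translateE; exists (x - l); last by rewrite linearB.
split; first exact: latticeB.
by rewrite /= linearB.
Qed.

(** The order of choices matters: the constant [C] and the finitely many cosets determine [d], then
    come the box covers with their thickness, then [r0]. The almost period is chosen last, so [r0]
    is common to all of them. *)
Lemma model_set_almost_periods (e : R) : 0 < e ->
  exists2 r0 : R, 0 < r0 & relatively_dense (almost_periods (model_set L W) e r0).
Proof.
move=> e0.
have [k [E [oE [[e1 e10 hE] hM]]]] := span_near0 (@lsubmx R 1 m n @` L).
have dense : forall (e : R) (t : 'rV[R]_k), 0 < e ->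
    exists l, exists s : 'rV[R]_k,
    [/\ L l, lsubmx l = s *m E & forall i, `|s ord0 i - t ord0 i| < e].
  exact: lattice_strip_dense.
have [C C0 hC] := atmost_strip latL oE dense.
have [K hK] := regular_window_boundary_bounded rW.
(* Two lattice points whose first projections differ by less than [e1] lie over the same coset, so
   [Y] represents every coset that matters near the boundary. *)
have [Y YL hY] := @finite_net R m _ L (@lsubmx R 1 m n) (K + 1) e1 e10.
(* Each representative costs [C * d], for a total of at most [e / 2]; the [+ 1] covers an empty
   [Y]. *)
pose d := e / 2 / (C * ((size Y)%:R + 1)).
have sY : 0 < (size Y)%:R + 1 :> R by rewrite ltr_wpDl.
have d0 : 0 < d by rewrite divr_gt0 ?mulr_gt0// divr_gt0.
have /choice[eta /choice[bx bxP]] : forall y : 'rV[R]_(m + n), exists eta : R,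
    exists l : seq ('rV[R]_k * 'rV[R]_k),
    let V := affine_subspace (lsubmx y) E in
    0 < eta /\
    [/\ forall cd, cd \in l -> forall i, cd.1 ord0 i < cd.2 ord0 i,
        rel_thickening V (rel_boundary V W) eta `<=` [set z | exists2 cd, cd \in l &
          exists2 t, box cd.1 cd.2 t & z = affine_chart (lsubmx y) E t]
      & \sum_(cd <- l) box_vol cd.1 cd.2 < d].
  move=> y; have [eta eta0 [l hl]] := regular_window_cover (lsubmx y) rW oE d0.
  by exists eta, l.
have [eta1 eta10 heta1] := common_lower_bound Y (fun y => (bxP y).1).
(* The three bounds keep the thickening inside every box cover, put [lsubmx l] in the span of [E],
   and keep the first projections concerned within [K + 1]. *)
pose eta0 := Num.min eta1 (Num.min e1 1).
have eta00 : 0 < eta0 by rewrite !lt_min eta10 e10 ltr01.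
have [eta0_1 [eta0_2 eta0_3]] : eta0 <= eta1 /\ eta0 <= e1 /\ eta0 <= 1.
  by rewrite /eta0 !ge_min !lexx !orbT.
have /choice[r1 r1P] : forall u : 'rV[R]_(m + n) * ('rV[R]_k * 'rV[R]_k),
    exists r1 : R, 0 < r1 /\ ((forall i, u.2.1 ord0 i < u.2.2 ord0 i) ->
    forall (r : R) (x : 'rV[R]_n), r1 <= r ->
    atmost [set l | [/\ L l, exists2 t, box u.2.1 u.2.2 t &
        lsubmx l = affine_chart (lsubmx u.1) E t & ball x r (rsubmx l)]]
      (C * box_vol u.2.1 u.2.2 * (2 * r) ^+ n)).
  move=> [y [c d']]; have [h|h] := pselect (forall i, c ord0 i < d' ord0 i).
    by have [r1 ? ?] := hC (lsubmx y) _ _ h; exists r1.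
  by exists 1.
pose r0 := 1 + \sum_(y <- Y) \sum_(cd <- bx y) r1 (y, cd).
have r00 : 0 < r0.
  rewrite ltr_pwDl// sumr_ge0// => y _; apply: sumr_ge0 => cd _.
  by rewrite ltW// (r1P _).1.
have r1r0 y cd : y \in Y -> cd \in bx y -> r1 (y, cd) <= r0.
  move=> yY cdy; rewrite /r0 (big_rem y)//= (big_rem cd)//=.
  have h1 : 0 <= \sum_(cd' <- rem cd (bx y)) r1 (y, cd').
    by apply: sumr_ge0 => ? _; rewrite ltW// (r1P _).1.
  have h2 : 0 <= \sum_(y' <- rem y Y) \sum_(cd <- bx y') r1 (y', cd).
    by apply: sumr_ge0 => ? _; apply: sumr_ge0 => ? _; rewrite ltW// (r1P _).1.
  lra.
exists r0 => //.
have [rN rN0 hN] := small_window_dense latL eta00.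
exists rN => // x0 r' /hN - /(_ x0)[l [Ll lsmall xl]].
exists (rsubmx l); split=> // r rr0.
have rpos : 0 < r by exact: lt_le_trans rr0.
apply: (@le_lt_trans _ _ (e / 2)%:E); last by rewrite lte_fin; lra.
apply: ge_ereal_sup => _ [x _ <-]; apply/card_by_vol_atmost => //.
pose St (y : 'rV[R]_(m + n)) (cd : 'rV[R]_k * 'rV[R]_k) : set 'rV[R]_(m + n) :=
  [set l | [/\ L l, exists2 t, box cd.1 cd.2 t &
     lsubmx l = affine_chart (lsubmx y) E t & ball x r (rsubmx l)]].
have hY1 y : y \in Y -> atmost [set l | exists2 cd, cd \in bx y & St y cd l]
    (C * d * (2 * r) ^+ n).
  move=> yY; have [_ [bpos _ bsum]] := bxP y.
  apply: (@atmost_le _ _ _ (\sum_(cd <- bx y) C * box_vol cd.1 cd.2 * (2 * r) ^+ n)).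
    rewrite -mulr_suml -mulr_sumr ler_wpM2r ?exprn_ge0 ?mulr_ge0 ?(ltW rpos)//.
    by rewrite ler_pM2l// ltW.
  apply: atmost_bigcup => cd cdy; apply: (r1P (y, cd)).2; first exact: bpos.
  by apply: le_trans rr0; exact: r1r0.
have := atmost_bigcup hY1.
rewrite big_const_seq count_predT iter_addr_0 => hall.
have {}hall := @atmost_image _ _ _ (@rsubmx R 1 m n) _ _ hall.
have tot : C * d * (2 * r) ^+ n *+ size Y <= e / 2 * (2 * r) ^+ n.
  rewrite -mulrnAl ler_wpM2r ?exprn_ge0 ?mulr_ge0 ?(ltW rpos)//.
  have -> : e / 2 = C * d * ((size Y)%:R + 1) by rewrite /d; field; rewrite !gt_eqF.
  have Cd0 : 0 <= C * d by rewrite ltW// mulr_gt0.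
  by rewrite -[leLHS]mulr_natr mulrDr mulr1 lerDl.
apply: atmost_sub (atmost_le tot hall) => p [/(model_set_translate Ll)[z [Lz Wz] <-] pb].
exists z => //=.
pose V := affine_subspace (lsubmx z) E.
have lE : (lsubmx l <= E)%MS.
  by apply: hE => [|i]; [exists l|exact: lt_le_trans (lsmall i) _].
have Vz : V (lsubmx z) by exists 0 => //; rewrite /affine_chart mul0mx addr0.
have Vz' : V (lsubmx z - lsubmx l).
  have /submxP[c cE] := lE; exists (- c) => //.
  by rewrite /affine_chart mulNmx -cE.
have [s bs sz] : exists2 s, rel_boundary V W s &
    forall i, `|lsubmx z ord0 i - s ord0 i| < eta0.
  case: Wz => -[W1 W2].
    have [s bs hs] := segment_meets_boundary Vz Vz' W1 W2; exists s => // i.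
    apply: le_lt_trans (hs i).1 _; rewrite -rVBE opprB addrC subrK.
    exact: lsmall.
  have [s bs hs] := segment_meets_boundary Vz' Vz W2 W1; exists s => // i.
  apply: le_lt_trans (hs i).2 _; rewrite distrC -rVBE opprB addrC subrK.
  exact: lsmall.
have zK i : `|lsubmx z ord0 i| <= K + 1.
  have := hK _ (rel_boundary_sub bs) i; have := sz i.
  rewrite !ler_norml ltr_norml => /andP[? ?] /andP[? ?].
  by apply/andP; split; lra.
have [y yY yz] := hY _ Lz zK.
have VE : V = affine_subspace (lsubmx y) E.
  apply/esym/affine_subspace_recenter; rewrite -linearB /=; apply: hE => [|i].
    by exists (z - y) => //; apply: latticeB => //; exact: YL.
  by rewrite linearB /= rVBE.
exists y => //.
have [_ [_ bcov _]] := bxP y.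
have /bcov[cd cdy [t tcd tz]] :
    rel_thickening (affine_subspace (lsubmx y) E)
      (rel_boundary (affine_subspace (lsubmx y) E) W) (eta y) (lsubmx z).
  apply: (@rel_thickening_mono _ _ _ _ eta0).
    by apply: le_trans eta0_1 _; exact: heta1.
  rewrite -VE; split=> //; exists s => //; apply/rV_ballP; split=> // i.
  by rewrite distrC.
by exists cd => //; split=> //; exists t.
Qed.

End model_sets.

Theorem theorem1 (R : realType) (n : nat) (hn : (0 < n)%N)
    (Gamma : set 'rV[R]_n) :
  [/\ (forall (m : nat) (Lambda : set 'rV[R]_(m + n)) (W : set 'rV[R]_m),
         (0 < m)%N -> lattice Lambda -> leb_measurable W -> regular_window W ->
         Gamma = model_set Lambda W -> delone Gamma ->
         almost_periodic_pattern Gamma),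
      (almost_periodic_pattern Gamma -> weakly_almost_periodic Gamma)
    & (weakly_almost_periodic Gamma -> has_uniform_density Gamma)].
Proof.
split; first 1 last.
- exact: almost_periodic_weakly.
- exact: weakly_almost_periodic_density.
move=> m Lambda W _ latL _ rW -> dG; split=> // e e0.
exact: model_set_almost_periods.
Qed.
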